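(* Let $\rho>0$, let $K\ge 1$ be an integer, and let $\widehat p_n(\theta)=\int_0^\infty p_n(t)e^{-\theta t}\,dt$, $0\le n\le K-1$, be the Laplace transform of the conditional sojourn time density $p_n(t)$ in the $M/M/1$ processor sharing queue with finite capacity $K$, arrival rate $\rho$ and service rate $1$. For $\theta>0$ put $$z_\pm=z_\pm(\theta)=\frac{1}{2\rho}\Big[1+\rho+\theta\pm\sqrt{(1+\rho+\theta)^2-4\rho}\Big],\qquad \alpha=\alpha(\theta)=\frac{z_+}{z_+-z_-},\qquad M=M(\theta)=z_-\Big(\frac{z_+}{z_-}\Big)^{\alpha},$$ $$G_n=G_n(\theta)=\int_0^{z_-}z^n(z_+-z)^{-\alpha}(z_--z)^{\alpha-1}\,dz,$$ $$H_n=H_n(\theta)=\frac{e^{i\alpha\pi}}{2\pi i}\int_{\mathcal C}z^n(z_+-z)^{-\alpha}(z-z_-)^{\alpha-1}\,dz,$$ where $\mathcal C$ is a closed contour in the complex $z$-plane that encircles the segment $[z_-,z_+]$ of the real axis counterclockwise, and the branch of the integrand is the one that is analytic in $\mathbb C\setminus[z_-,z_+]$ (for $n\ge 0$) and for which $e^{i\alpha\pi}(z_+-z)^{-\alpha}(z-z_-)^{\alpha-1}\sim 1/z$ as $z\to\infty$. Let $\Delta G_K=G_K-G_{K-1}$ and $\Delta H_K=H_K-H_{K-1}$. Then $$\widehat p_n(\theta)=MG_n\sum_{l=0}^n\rho^lH_l+MH_n\sum_{l=n+1}^{K-1}\rho^lG_l-\frac{\Delta G_K}{\Delta H_K}\,MH_n\sum_{l=0}^{K-1}\rho^lH_l,\qquad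 n=0,1,\dots,K-2,$$ and $$\widehat p_{K-1}(\theta)=\frac{1}{K\rho^K\Delta H_K}\sum_{l=0}^{K-1}\rho^lH_l.$$
   Context: Model: a single-server queue with the processor sharing discipline (when $m\geq 1$ customers are present each is served at rate $1/m$), Poisson arrivals with rate $\lambda=\rho>0$, i.i.d. exponential service requirements with mean $1/\mu=1$, and capacity of at most $K$ customers; arrivals that find the system full are turned away and lost. Let $\mathbf V$ be the sojourn time of a tagged (accepted) customer and $\mathbf N(0^-)$ the number of customers present immediately before it arrives. The conditional density is $p_n(t)\,dt=\Pr[\mathbf V\in(t,t+dt)\mid \mathbf N(0^-)=n]$, $0\le n\le K-1$. The functions $p_n(t)$ are characterized by the evolution equation (taken as the starting point) $$p_n'(t)=\rho\,p_{n+1}(t)-(1+\rho)\,p_n(t)+\frac{n}{n+1}\,p_{n-1}(t),\qquad 0\le n\le K-1,\ t>0,$$ with initial condition $p_n(0)=\frac1{n+1}$ and the artificial boundary condition $p_K(t)=p_{K-1}(t)$ (which defines $p_K$; the term with $p_{n-1}$ is absent for $n=0$). Equivalently, the transforms satisfy $$(n+1)\rho\,\widehat p_{n+1}(\theta)-(n+1)(1+\rho+\theta)\,\widehat p_n(\theta)+n\,\widehat p_{n-1}(\theta)=-1,\qquad n=0,1,\dots,K-1,$$ with $\widehat p_K(\theta)=\widehat p_{K-1}(\theta)$. For real $\theta>0$ one has $z_+>z_->0$. Real powers of positive real numbers are the positive ones. *)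

(* Defs.v *)
From Stdlib Require Import Reals.
From Coquelicot Require Import Coquelicot.

Open Scope R_scope.

(** ** The conditional sojourn time densities *)

(** [p n t] is the density p_n(t).  The value [p K] is the artificial one
    supplied by the boundary condition.  For [n = 0] the truncated index
    [n - 1] is harmless: the coefficient [0 / 1] removes that term.  Right
    continuity at 0 ties the initial value to the equation, which is only
    required for [t > 0]. *)
Record conditional_sojourn_densities (rho : R) (K : nat) (p : nat -> R -> R)
    : Prop := {
  csd_evolution : forall (n : nat) (t : R), (n < K)%nat -> 0 < t ->
    is_derive (p n) t
      (rho * p (S n) t - (1 + rho) * p n t
       + INR n / INR (n + 1) * p (n - 1)%nat t);
  csd_initial : forall n : nat, (n < K)%nat -> p n 0 = 1 / INR (n + 1);
  csd_right_continuous : forall n : nat, (n < K)%nat ->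
    filterlim (p n) (at_right 0) (locally (p n 0));
  csd_boundary : forall t : R, 0 <= t -> p K t = p (K - 1)%nat t
}.

Definition ex_laplace (f : R -> R) (theta : R) : Prop :=
  ex_RInt_gen (fun t => f t * exp (- (theta * t)))
    (at_point 0) (Rbar_locally p_infty).

Definition laplace (f : R -> R) (theta : R) : R :=
  RInt_gen (fun t => f t * exp (- (theta * t)))
    (at_point 0) (Rbar_locally p_infty).

(** ** Real quantities *)

Definition z_plus (rho theta : R) : R :=
  1 / (2 * rho)
  * (1 + rho + theta + sqrt ((1 + rho + theta) ^ 2 - 4 * rho)).

Definition z_minus (rho theta : R) : R :=
  1 / (2 * rho)
  * (1 + rho + theta - sqrt ((1 + rho + theta) ^ 2 - 4 * rho)).

Definition alpha (rho theta : R) : R :=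
  z_plus rho theta / (z_plus rho theta - z_minus rho theta).

Definition M (rho theta : R) : R :=
  z_minus rho theta
  * Rpower (z_plus rho theta / z_minus rho theta) (alpha rho theta).

(** [alpha > 1], so this is a proper integral.  [Rpower] is not the real power
    at the endpoint [z = z_minus], where its base is 0; [RInt] ignores the
    values of the integrand at the endpoints. *)
Definition G (rho theta : R) (n : nat) : R :=
  RInt (fun z => z ^ n
                 * Rpower (z_plus rho theta - z) (- alpha rho theta)
                 * Rpower (z_minus rho theta - z) (alpha rho theta - 1))
    0 (z_minus rho theta).

Definition Delta_G (rho theta : R) (K : nat) : R :=
  G rho theta K - G rho theta (K - 1).

(** ** Contour integrals *)

(** Contours are parametrized by [0, 1]. *)
Definition piecewise_C1 (g : R -> C) : Prop :=
  exists (N : nat) (s : nat -> R),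
    s 0%nat = 0 /\ s N = 1 /\
    (forall i : nat, (i < N)%nat -> s i < s (S i)) /\
    (forall i : nat, (i < N)%nat ->
       exists h dh : R -> C,
         (forall t : R, is_derive (V := C_R_NormedModule) h t (dh t)) /\
         (forall t : R, continuous dh t) /\
         (forall t : R, s i <= t <= s (S i) -> g t = h t)).

Definition path_derive (g : R -> C) (t : R) : C :=
  (Derive (fun u => Re (g u)) t, Derive (fun u => Im (g u)) t).

Definition contour_integral (f : C -> C) (g : R -> C) : C :=
  RInt (V := C_R_CompleteNormedModule)
    (fun t => (f (g t) * path_derive g t)%C) 0 1.

Definition on_segment (a b : R) (z : C) : Prop := a <= Re z <= b /\ Im z = 0.

(** [g] is a closed contour off the segment [a, b] of the real axis, having
    winding number 1 about each of its points. *)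
Definition encircles_counterclockwise (g : R -> C) (a b : R) : Prop :=
  piecewise_C1 g /\
  g 0 = g 1 /\
  (forall t : R, 0 <= t <= 1 -> ~ on_segment a b (g t)) /\
  (forall x : R, a <= x <= b ->
     (contour_integral (fun z => / (z - RtoC x)) g / (2 * RtoC PI * Ci))%C
     = RtoC 1).

Definition Cexp (z : C) : C :=
  (exp (Re z) * cos (Im z), exp (Re z) * sin (Im z)).

(** [Phi] is the branch of the multivalued function
    (z_+ - z)^(-alpha) (z - z_-)^(alpha - 1): it is holomorphic off the cut,
    its value at each point is given by some determinations [w1], [w2] of the
    logarithms of z_+ - z and z - z_-, and it is normalized at infinity by
    e^(i alpha pi) Phi(z) ~ 1/z. *)
Record integrand_branch (rho theta : R) (Phi : C -> C) : Prop := {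
  branch_analytic : forall z : C,
    ~ on_segment (z_minus rho theta) (z_plus rho theta) z ->
    ex_derive (K := C_AbsRing) (V := C_NormedModule) Phi z;
  branch_value : forall z : C,
    ~ on_segment (z_minus rho theta) (z_plus rho theta) z ->
    exists w1 w2 : C,
      Cexp w1 = (RtoC (z_plus rho theta) - z)%C /\
      Cexp w2 = (z - RtoC (z_minus rho theta))%C /\
      Phi z = (Cexp (- RtoC (alpha rho theta) * w1)
               * Cexp ((RtoC (alpha rho theta) - 1) * w2))%C;
  branch_at_infinity : forall eps : posreal, exists A : R, forall z : C,
    A < Cmod z ->
    Cmod (Cexp (Ci * RtoC (alpha rho theta) * RtoC PI) * Phi z / (1 / z) - 1)
    < eps
}.

Definition H (rho theta : R) (Phi : C -> C) (g : R -> C) (n : nat) : C :=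
  (Cexp (Ci * RtoC (alpha rho theta) * RtoC PI) / (2 * RtoC PI * Ci)
   * contour_integral (fun z => z ^ n * Phi z) g)%C.

Definition Delta_H (rho theta : R) (Phi : C -> C) (g : R -> C) (K : nat) : C :=
  (H rho theta Phi g K - H rho theta Phi g (K - 1))%C.

(* Main.v *)
Require Import Defs.
From Stdlib Require Import Reals Lra Lia.
From Coquelicot Require Import Coquelicot.

Open Scope R_scope.

(** Multiplied by [n + 1], the evolution equation becomes under the Laplace
transform the three-term recurrence [sojourn_op rho theta x n = -1], with
[x K = x (K - 1)].  The theorem is the solution of this boundary value
problem by a discrete Green function.

The sequences [G] and [H] are moments of the same weight, up to a phase,
w = (z_+ - z)^(-alpha) (z - z_-)^(alpha - 1), and the exponents are such that

  (rho z^n (z - z_+) (z - z_-) w)'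
    = ((n + 1) rho z^(n+1) - (n + 1) (1 + rho + theta) z^n + n z^(n-1)) w.

Integrated over the closed contour this gives the homogeneous recurrence for
[H] at every [n] ([H_recurrence]); integrated over [0, z_-] it gives the one
for [G], except that at [n = 0] the endpoint 0 contributes -1/M
([G_recurrence], [M_normalization]).  Moreover [H 0 = 1] ([H_0]): in
s Phi(z_- + s (z - z_-)) the factor s can be increased from 1 to infinity
without changing the integral, and the limit is the kernel 1 / (z - z_-), whose
integral is the winding number.  So the [H n] are real, positive and increasing
([homogeneous_increasing]), and the Casoratian of [G] and [H], weighted with
(n + 1) rho^(n+1), is the constant 1/M ([casoratian]).  Summation by parts then
shows that the announced expression satisfies the recurrence with right-hand
side -1 ([green_solution_op]); its multiple of [H n] is the one that produces
the boundary condition, and at [n = K - 1] the Casoratian collapses it to the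
second formula.

It remains to see that the Laplace integrals converge, and to that solution.
The integrals truncated at T solve the same boundary value problem up to an
error (n + 1) p_n(T) e^(-theta T) ([truncated_laplace_op]), which vanishes as
T grows because the energy, the sum of (n + 1) rho^n p_n^2, is nonincreasing.
As [H] is increasing, the boundary value problem is stable
([sojourn_op_stable]), so the truncated integrals converge to its solution:
convergence and value come together. *)

(** * Complex-valued functions of a real variable *)

(** Componentwise, so that the calculus of real functions applies.  Holomorphic
functions enter only through their composition with such curves. *)
Definition curve_derive (f : R -> C) (t : R) (l : C) : Prop :=
  is_derive (fun u => Re (f u)) t (Re l) /\
  is_derive (fun u => Im (f u)) t (Im l).

Lemma C_eq (a b : C) : Re a = Re b -> Im a = Im b -> a = b.
Proof. destruct a, b; simpl; intros -> ->; reflexivity. Qed.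

Lemma is_derive_curve (h : R -> C) (t : R) (d : C) :
  is_derive (V := C_R_NormedModule) h t d -> curve_derive h t d.
Proof.
  intros Hh; split.
  - refine (filterdiff_comp' (V := C_R_NormedModule) h (fun z : C => Re z) t
              (fun y => scal y d) (fun z : C => Re z) Hh _).
    apply filterdiff_linear, is_linear_fst.
  - refine (filterdiff_comp' (V := C_R_NormedModule) h (fun z : C => Im z) t
              (fun y => scal y d) (fun z : C => Im z) Hh _).
    apply filterdiff_linear, is_linear_snd.
Qed.

Lemma curve_is_derive (h : R -> C) (t : R) (d : C) :
  curve_derive h t d -> is_derive (V := C_R_NormedModule) h t d.
Proof.
  intros [H1 H2].
  refine (filterdiff_ext (K := R_AbsRing) (U := AbsRing_NormedModule R_AbsRing)
    (V := C_R_NormedModule) (fun t => (Re (h t), Im (h t))) h _ _ _).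
  { intros y; destruct (h y); reflexivity. }
  apply (filterdiff_comp'_2 (K := R_AbsRing) (T := AbsRing_NormedModule R_AbsRing)
    (U := R_NormedModule) (V := R_NormedModule) (W := C_R_NormedModule)
    (fun t => Re (h t)) (fun t => Im (h t)) (fun a b => (a, b) : C) t
    (fun y => scal y (Re d)) (fun y => scal y (Im d)) (fun a b => (a, b) : C) H1 H2).
  apply (@filterdiff_ext R_AbsRing C_R_NormedModule C_R_NormedModule _ _ (fun x => x));
    [now intros []|].
  apply (@filterdiff_ext_lin R_AbsRing C_R_NormedModule C_R_NormedModule _ _ _ (fun x => x));
    [|now intros []].
  apply filterdiff_id.
Qed.

Lemma curve_derive_ext (f g : R -> C) t l l' :
  (forall u, f u = g u) -> l = l' -> curve_derive f t l -> curve_derive g t l'.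
Proof.
  intros E <- [H1 H2]; split.
  - apply (is_derive_ext (fun u => Re (f u))); [intros u; now rewrite E | easy].
  - apply (is_derive_ext (fun u => Im (f u))); [intros u; now rewrite E | easy].
Qed.

Lemma curve_derive_mult f g t l m :
  curve_derive f t l -> curve_derive g t m ->
  curve_derive (fun u => f u * g u)%C t (l * g t + f t * m)%C.
Proof.
  intros [H1 H2] [H3 H4]; split; simpl.
  - apply (is_derive_ext (fun u => Re (f u) * Re (g u) - Im (f u) * Im (g u)));
      [reflexivity|].
    evar_last.
    { apply (is_derive_minus (V := R_NormedModule));
      apply (is_derive_mult (K := R_AbsRing)); try eassumption; apply Rmult_comm. }
    unfold minus, plus, opp, mult, Re, Im; simpl. ring.
  - apply (is_derive_ext (fun u => Re (f u) * Im (g u) + Im (f u) * Re (g u)));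
      [reflexivity|].
    evar_last.
    { apply (is_derive_plus (V := R_NormedModule));
      apply (is_derive_mult (K := R_AbsRing)); try eassumption; apply Rmult_comm. }
    unfold minus, plus, opp, mult, Re, Im; simpl. ring.
Qed.

Lemma curve_derive_plus f g t l m :
  curve_derive f t l -> curve_derive g t m ->
  curve_derive (fun u => f u + g u)%C t (l + m)%C.
Proof.
  intros [H1 H2] [H3 H4]; split; simpl;
  now apply (is_derive_plus (V := R_NormedModule)).
Qed.

Lemma curve_derive_const c t : curve_derive (fun _ => c) t 0%C.
Proof. split; apply (is_derive_const (V := R_NormedModule)). Qed.

Lemma curve_derive_RtoC (f : R -> R) (t l : R) : is_derive f t l ->
  curve_derive (fun u => RtoC (f u)) t (RtoC l).
Proof. intros Hf; split; [exact Hf | exact (is_derive_const (V := R_NormedModule) 0 t)]. Qed.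

Lemma curve_derive_pow f t l n :
  curve_derive f t l ->
  curve_derive (fun u => f u ^ n)%C t (RtoC (INR n) * f t ^ (n - 1) * l)%C.
Proof.
  intros Hf; induction n as [|n IH].
  - apply (curve_derive_ext (fun _ => RtoC 1) _ t 0%C); [reflexivity| |apply curve_derive_const].
    simpl; ring.
  - eapply curve_derive_ext; [| |exact (curve_derive_mult _ _ _ _ _ Hf IH)].
    + reflexivity.
    + rewrite S_INR, RtoC_plus. replace (S n - 1)%nat with n by lia.
      destruct n as [|n]; [simpl; ring|].
      replace (S n - 1)%nat with n by lia. simpl Cpow. ring.
Qed.

Lemma continuous_C {T : UniformSpace} (f : T -> C) (x : T) :
  continuous (fun y => Re (f y)) x -> continuous (fun y => Im (f y)) x ->
  continuous (U := C_UniformSpace) f x.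
Proof.
  intros H1 H2.
  apply (continuous_ext (U := C_UniformSpace) (fun y => (Re (f y), Im (f y)))).
  { intros y; destruct (f y); reflexivity. }
  apply filterlim_filter_le_2 with (2 := filterlim_pair _ _ H1 H2).
  intros P [eps He]. exists (fun u => ball (Re (f x)) eps u) (fun u => ball (Im (f x)) eps u).
  - apply locally_ball.
  - apply locally_ball.
  - intros u v Hu Hv. apply He. split; assumption.
Qed.

Lemma continuous_Re {T : UniformSpace} (f : T -> C) (x : T) :
  continuous (U := C_UniformSpace) f x -> continuous (fun y => Re (f y)) x.
Proof. intros Hf. apply (continuous_comp (V := C_UniformSpace) f Re);
  [exact Hf | apply continuous_fst]. Qed.

Lemma continuous_Im {T : UniformSpace} (f : T -> C) (x : T) :
  continuous (U := C_UniformSpace) f x -> continuous (fun y => Im (f y)) x.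
Proof. intros Hf. apply (continuous_comp (V := C_UniformSpace) f Im);
  [exact Hf | apply continuous_snd]. Qed.

Lemma continuous_Cmult {T : UniformSpace} (f g : T -> C) (x : T) :
  continuous (U := C_UniformSpace) f x -> continuous (U := C_UniformSpace) g x ->
  continuous (U := C_UniformSpace) (fun y => f y * g y)%C x.
Proof.
  intros Hf Hg.
  assert (Hm : forall u v : T -> R, continuous u x -> continuous v x ->
    continuous (fun y => u y * v y) x)
    by (intros u v Hu Hv; exact (continuous_mult (K := R_AbsRing) u v x Hu Hv)).
  pose (f1 := fun y => Re (f y)). pose (f2 := fun y => Im (f y)).
  pose (g1 := fun y => Re (g y)). pose (g2 := fun y => Im (g y)).
  assert (F1 : continuous f1 x) by now apply continuous_Re.
  assert (F2 : continuous f2 x) by now apply continuous_Im.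
  assert (G1 : continuous g1 x) by now apply continuous_Re.
  assert (G2 : continuous g2 x) by now apply continuous_Im.
  apply continuous_C.
  - exact (continuous_minus (V := R_NormedModule) (fun y => f1 y * g1 y) (fun y => f2 y * g2 y) x
      (Hm f1 g1 F1 G1) (Hm f2 g2 F2 G2)).
  - exact (continuous_plus (V := R_NormedModule) (fun y => f1 y * g2 y) (fun y => f2 y * g1 y) x
      (Hm f1 g2 F1 G2) (Hm f2 g1 F2 G1)).
Qed.

Lemma continuous_Cplus {T : UniformSpace} (f g : T -> C) (x : T) :
  continuous (U := C_UniformSpace) f x -> continuous (U := C_UniformSpace) g x ->
  continuous (U := C_UniformSpace) (fun y => f y + g y)%C x.
Proof.
  intros Hf Hg.
  apply continuous_C.
  - exact (continuous_plus (V := R_NormedModule) (fun y => Re (f y)) (fun y => Re (g y)) x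
      (continuous_Re f x Hf) (continuous_Re g x Hg)).
  - exact (continuous_plus (V := R_NormedModule) (fun y => Im (f y)) (fun y => Im (g y)) x
      (continuous_Im f x Hf) (continuous_Im g x Hg)).
Qed.

Lemma continuous_Rpow (n : nat) (x : R) : continuous (fun z => z ^ n) x.
Proof.
  apply (ex_derive_continuous (V := R_NormedModule)). auto_derive. auto.
Qed.

Lemma continuous_sqr_modulus {T : UniformSpace} (f : T -> C) (x : T) :
  continuous (U := C_UniformSpace) f x ->
  continuous (fun y => Re (f y) ^ 2 + Im (f y) ^ 2) x.
Proof.
  intros Hf.
  apply (continuous_plus (V := R_NormedModule)
    (fun y => Re (f y) ^ 2) (fun y => Im (f y) ^ 2)).
  - apply (continuous_comp (fun y => Re (f y)) (fun u => u ^ 2));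
      [now apply continuous_Re | apply continuous_Rpow].
  - apply (continuous_comp (fun y => Im (f y)) (fun u => u ^ 2));
      [now apply continuous_Im | apply continuous_Rpow].
Qed.

Lemma continuous_Cpow {T : UniformSpace} (f : T -> C) (n : nat) (x : T) :
  continuous (U := C_UniformSpace) f x ->
  continuous (U := C_UniformSpace) (fun y => f y ^ n)%C x.
Proof.
  intros Hf; induction n as [|n IH]; simpl.
  - apply (continuous_const (V := C_UniformSpace)).
  - now apply continuous_Cmult.
Qed.

Lemma continuous_Cinv {T : UniformSpace} (f : T -> C) (x : T) :
  f x <> 0%C -> continuous (U := C_UniformSpace) f x ->
  continuous (U := C_UniformSpace) (fun y => / f y)%C x.
Proof.
  intros Hx Hf.
  assert (Hp : Re (f x) ^ 2 + Im (f x) ^ 2 <> 0).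
  { intros E. apply Hx, C_eq; simpl; nra. }
  assert (Hc : continuous (fun y => / (Re (f y) ^ 2 + Im (f y) ^ 2)) x).
  { apply (continuous_comp (fun y => Re (f y) ^ 2 + Im (f y) ^ 2) Rinv);
      [now apply continuous_sqr_modulus | now apply continuous_Rinv]. }
  pose (f1 := fun y => Re (f y)). pose (f2 := fun y => - Im (f y)).
  assert (F1 : continuous f1 x) by now apply continuous_Re.
  assert (F2 : continuous f2 x).
  { apply (continuous_opp (V := R_NormedModule) (fun y => Im (f y))). now apply continuous_Im. }
  apply continuous_C.
  - exact (continuous_mult (K := R_AbsRing) f1 _ x F1 Hc).
  - exact (continuous_mult (K := R_AbsRing) f2 _ x F2 Hc).
Qed.

Notation Ccontinuous := (continuous (T := C_UniformSpace) (U := C_UniformSpace)).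

Lemma curve_derive_continuous h t d :
  curve_derive h t d -> continuous (U := C_UniformSpace) h t.
Proof.
  intros [H1 H2]; apply continuous_C; apply (ex_derive_continuous (V := R_NormedModule));
  eexists; eassumption.
Qed.

Lemma is_RInt_curve (F f : R -> C) (a b : R) :
  (forall t, Rmin a b <= t <= Rmax a b -> curve_derive F t (f t)) ->
  (forall t, Rmin a b <= t <= Rmax a b -> continuous (U := C_UniformSpace) f t) ->
  is_RInt (V := C_R_NormedModule) f a b (F b - F a)%C.
Proof.
  intros HF Hf.
  apply (is_RInt_fct_extend_pair (U := R_NormedModule) (V := R_NormedModule) f).
  - refine (is_RInt_derive (V := R_CompleteNormedModule) (fun t => Re (F t)) (fun t => Re (f t))
      a b _ _).
    + intros t Ht. apply HF, Ht.
    + intros t Ht. apply continuous_Re, Hf, Ht.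
  - refine (is_RInt_derive (V := R_CompleteNormedModule) (fun t => Im (F t)) (fun t => Im (f t))
      a b _ _).
    + intros t Ht. apply HF, Ht.
    + intros t Ht. apply continuous_Im, Hf, Ht.
Qed.

Lemma norm_Cmod (z : C) : norm (V := C_R_NormedModule) z = Cmod z.
Proof.
  unfold norm; simpl. unfold prod_norm, Cmod, norm; simpl. unfold abs; simpl.
  f_equal. rewrite !Rmult_1_r, <- !Rabs_mult, !Rabs_pos_eq; nra.
Qed.

(** A complex differential is in particular a real differential of the plane,
for the same norm, so the real chain rule applies. *)
Lemma curve_derive_holomorphic (F : C -> C) (h : R -> C) (t : R) (l d : C) :
  is_derive (K := C_AbsRing) (V := C_NormedModule) F (h t) l ->
  curve_derive h t d ->
  curve_derive (fun u => F (h u)) t (l * d)%C.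
Proof.
  intros HF Hh. apply is_derive_curve. apply curve_is_derive in Hh.
  refine (filterdiff_ext_lin (K := R_AbsRing) (U := AbsRing_NormedModule R_AbsRing)
    (V := C_R_NormedModule) _
    (fun y : R => (l * scal (V := C_R_NormedModule) y d)%C) _ _ _).
  2: { intros y. apply C_eq; unfold scal; simpl; unfold scal; simpl; unfold mult; simpl; ring. }
  refine (filterdiff_comp' (K := R_AbsRing) (U := AbsRing_NormedModule R_AbsRing)
    (V := C_R_NormedModule) (W := C_R_NormedModule) h F t
              (fun y => scal y d) (fun y : C => (l * y)%C) Hh _).
  destruct HF as [_ HF]. split.
  - split.
    + intros x y. apply (Cmult_plus_distr_l l x y).
    + intros k x. apply C_eq; unfold scal; simpl; unfold scal; simpl; unfold mult; simpl; ring.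
    + exists (Cmod l + 1). split; [generalize (Cmod_ge_0 l); lra|].
      intros x.
      rewrite !norm_Cmod, Cmod_mult. generalize (Cmod_ge_0 x); nra.
  - intros x Hx eps.
    assert (x = h t) as ->.
    { symmetry. apply (is_filter_lim_locally_unique (K := R_AbsRing) (V := C_R_NormedModule)).
      exact Hx. }
    specialize (HF (h t)).
    assert (Hl : is_filter_lim (T := AbsRing_UniformSpace C_AbsRing)
      (locally (T := AbsRing_UniformSpace C_AbsRing) (h t)) (h t)) by (intros P HP; exact HP).
    specialize (HF Hl eps).
    apply locally_C in HF.
    revert HF. apply filter_imp. intros y Hy.
    rewrite !norm_Cmod.
    replace (minus (G := C_R_NormedModule) (minus (G := C_R_NormedModule) (F y) (F (h t)))
      (l * minus (G := C_R_NormedModule) y (h t))%C)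
      with (minus (G := C_NormedModule) (minus (G := C_NormedModule) (F y) (F (h t)))
                   (scal (V := C_NormedModule) (minus (G := C_AbsRing) y (h t)) l)); [exact Hy|].
    unfold minus, scal, plus, opp; simpl. unfold mult; simpl.
    apply C_eq; unfold Cplus, Copp, plus, opp; simpl; unfold plus, opp; simpl; ring.
Qed.

(** * The logarithmic derivative of the branch *)

Lemma Cmod_Cexp (w : C) : Cmod (Cexp w) = exp (Re w).
Proof.
  unfold Cmod, Cexp; simpl.
  replace (_ + _) with (exp (Re w) * exp (Re w) * (sin (Im w) ^ 2 + cos (Im w) ^ 2)) by ring.
  rewrite <- !Rsqr_pow2, sin2_cos2, Rmult_1_r.
  apply sqrt_square. left; apply exp_pos.
Qed.

Lemma Cexp_ne_0 (w : C) : Cexp w <> 0%C.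
Proof.
  intros E. apply (f_equal Cmod) in E. rewrite Cmod_Cexp, Cmod_0 in E.
  generalize (exp_pos (Re w)); lra.
Qed.

Lemma off_segment_alt a b z :
  ~ on_segment a b z <-> (Im z < 0 \/ 0 < Im z) \/ (Re z < a \/ b < Re z).
Proof.
  unfold on_segment; split; intros Hz; [|lra].
  destruct (Rtotal_order (Im z) 0) as [|[|]]; [tauto| |tauto].
  right. destruct (Rlt_le_dec (Re z) a); [tauto|].
  destruct (Rlt_le_dec b (Re z)); tauto.
Qed.

Lemma open_off_segment a b :
  open (T := C_UniformSpace) (fun z => ~ on_segment a b z).
Proof.
  assert (Ho : open (T := C_UniformSpace)
    (fun z : C => (Im z < 0 \/ 0 < Im z) \/ (Re z < a \/ b < Re z))).
  { repeat apply open_or.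
    - apply (open_comp (T := C_UniformSpace) Im (fun x => x < 0)); [|apply open_lt].
      intros; apply continuous_snd.
    - apply (open_comp (T := C_UniformSpace) Im (fun x => 0 < x)); [|apply open_gt].
      intros; apply continuous_snd.
    - apply (open_comp (T := C_UniformSpace) Re (fun x => x < a)); [|apply open_lt].
      intros; apply continuous_fst.
    - apply (open_comp (T := C_UniformSpace) Re (fun x => b < x)); [|apply open_gt].
      intros; apply continuous_fst. }
  intros z Hz. apply off_segment_alt in Hz.
  generalize (Ho z Hz). apply filter_imp. intros y. apply off_segment_alt.
Qed.

Lemma off_segment_ne a b (x : R) z : a <= x <= b -> ~ on_segment a b z -> (z - RtoC x)%C <> 0%C.
Proof.
  intros Hx Hz E. apply Hz.
  assert (E1 := f_equal Re E). assert (E2 := f_equal Im E).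
  simpl in E1, E2. unfold on_segment, Re, Im in *; lra.
Qed.

Lemma sum_sqr_pos x y : x <> 0 \/ y <> 0 -> 0 < x ^ 2 + y ^ 2.
Proof.
  intros [Hx | Hx]; apply pow2_gt_0 in Hx;
  [generalize (pow2_ge_0 y) | generalize (pow2_ge_0 x)]; lra.
Qed.

Lemma ln_Cmod (z : C) : z <> 0%C -> 2 * ln (Cmod z) = ln (Re z ^ 2 + Im z ^ 2).
Proof.
  intros Hz. apply Cmod_gt_0 in Hz.
  rewrite <- Cmod2_alt. simpl. rewrite Rmult_1_r, ln_mult by assumption. ring.
Qed.

(** The squared modulus of (b - z)^(-al) (z - a)^(al - 1): unlike the power
itself, it does not depend on the determination of the logarithms. *)
Definition branch_sqr_modulus (a b al : R) (z : C) : R :=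
  exp (- al * ln ((b - Re z) ^ 2 + Im z ^ 2)
       + (al - 1) * ln ((Re z - a) ^ 2 + Im z ^ 2)).

Lemma branch_value_nonzero a b al z w :
  (exists w1 w2 : C, Cexp w1 = (RtoC b - z)%C /\ Cexp w2 = (z - RtoC a)%C /\
     w = (Cexp (- RtoC al * w1) * Cexp ((RtoC al - 1) * w2))%C) -> w <> 0%C.
Proof.
  intros (w1 & w2 & _ & _ & ->). apply Cmult_neq_0; apply Cexp_ne_0.
Qed.

Lemma branch_value_sqr_modulus a b al z w :
  (exists w1 w2 : C, Cexp w1 = (RtoC b - z)%C /\ Cexp w2 = (z - RtoC a)%C /\
     w = (Cexp (- RtoC al * w1) * Cexp ((RtoC al - 1) * w2))%C) ->
  Re w ^ 2 + Im w ^ 2 = branch_sqr_modulus a b al z.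
Proof.
  intros (w1 & w2 & E1 & E2 & ->).
  rewrite <- Cmod2_alt, Cmod_mult, !Cmod_Cexp.
  unfold branch_sqr_modulus.
  assert (L1 : ln ((b - Re z) ^ 2 + Im z ^ 2) = 2 * Re w1).
  { assert (Hn := Cexp_ne_0 w1). rewrite E1 in Hn. apply ln_Cmod in Hn.
    rewrite <- E1, Cmod_Cexp, ln_exp in Hn. rewrite Hn. rewrite E1. f_equal.
    unfold Re, Im; simpl. ring. }
  assert (L2 : ln ((Re z - a) ^ 2 + Im z ^ 2) = 2 * Re w2).
  { assert (Hn := Cexp_ne_0 w2). rewrite E2 in Hn. apply ln_Cmod in Hn.
    rewrite <- E2, Cmod_Cexp, ln_exp in Hn. rewrite Hn. rewrite E2. f_equal.
    unfold Re, Im; simpl. ring. }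
  rewrite L1, L2, <- exp_plus. simpl pow. rewrite Rmult_1_r, <- exp_plus.
  f_equal. destruct w1, w2; unfold Re, Im; simpl. ring.
Qed.

Definition log_derivative (a b al : R) (z : C) : C :=
  (RtoC al / (RtoC b - z) + (RtoC al - 1) / (z - RtoC a))%C.

(** The determinations of the logarithms are only known pointwise, so they
cannot be differentiated.  But the modulus of [Phi] is an explicit smooth
function, and a function that is complex differentiable with derivative l has
(|Phi|^2)' = 2 Re (conj Phi l d) in the direction d; the directions 1 and i
determine conj Phi l, hence l. *)
Lemma branch_derive (a b al : R) (Phi : C -> C) :
  a < b ->
  (forall z, ~ on_segment a b z -> ex_derive (K := C_AbsRing) (V := C_NormedModule) Phi z) ->
  (forall z, ~ on_segment a b z ->
    exists w1 w2 : C, Cexp w1 = (RtoC b - z)%C /\ Cexp w2 = (z - RtoC a)%C /\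
     Phi z = (Cexp (- RtoC al * w1) * Cexp ((RtoC al - 1) * w2))%C) ->
  forall z, ~ on_segment a b z ->
  is_derive (K := C_AbsRing) (V := C_NormedModule) Phi z (Phi z * log_derivative a b al z)%C.
Proof.
  intros Hab Hd Hv z Hz.
  destruct (Hd z Hz) as [l Hl].
  enough (l = (Phi z * log_derivative a b al z)%C) as <- by exact Hl.
  assert (Hn : Phi z <> 0%C) by (eapply branch_value_nonzero, Hv, Hz).
  assert (Hm : forall h : R -> C, forall d : C, curve_derive h 0 d -> h 0 = z ->
     is_derive (fun t => branch_sqr_modulus a b al (h t)) 0
       (2 * (Re (Phi z) * Re (l * d)%C + Im (Phi z) * Im (l * d)%C))).
  { intros h d Hh E.
    apply (is_derive_ext_loc (fun t => Re (Phi (h t)) ^ 2 + Im (Phi (h t)) ^ 2)).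
    - assert (Hc := curve_derive_continuous _ _ _ Hh).
      assert (Hz' := Hz). rewrite <- E in Hz'.
      generalize (Hc _ (open_off_segment a b _ Hz')). unfold filtermap.
      apply filter_imp. intros t Ht. apply branch_value_sqr_modulus, Hv, Ht.
    - subst z. destruct (curve_derive_holomorphic Phi h 0 l d Hl Hh) as [D1 D2].
      evar_last.
      + apply (is_derive_plus (V := R_NormedModule)); apply is_derive_pow; eassumption.
      + unfold plus; simpl. ring. }
  assert (Hx := Hm (fun t => (Re z + t, Im z)) (RtoC 1)).
  assert (Hy := Hm (fun t => (Re z, Im z + t)) Ci).
  clear Hm.
  assert (P1 : 0 < (b - Re z) ^ 2 + Im z ^ 2)
    by (apply off_segment_alt in Hz; apply sum_sqr_pos; lra).
  assert (P2 : 0 < (Re z - a) ^ 2 + Im z ^ 2)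
    by (apply off_segment_alt in Hz; apply sum_sqr_pos; lra).
  assert (Ex : 2 * (Re (Phi z) * Re (l * 1)%C + Im (Phi z) * Im (l * 1)%C)
    = branch_sqr_modulus a b al z * (2 * Re (log_derivative a b al z))).
  { rewrite <- (is_derive_unique _ _ _
      (Hx ltac:(split; simpl; auto_derive; auto; ring) ltac:(apply C_eq; simpl; ring))).
    apply is_derive_unique. unfold branch_sqr_modulus; simpl Re; simpl Im.
    auto_derive.
    - rewrite !Rplus_0_r. repeat split; simpl in P1, P2; lra.
    - rewrite !Rplus_0_r. simpl in P1, P2.
      unfold log_derivative, Re, Im in *; simpl; unfold Rminus in *; field; lra. }
  assert (Ey : 2 * (Re (Phi z) * Re (l * Ci)%C + Im (Phi z) * Im (l * Ci)%C)
    = branch_sqr_modulus a b al z * (- 2 * Im (log_derivative a b al z))).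
  { rewrite <- (is_derive_unique _ _ _
      (Hy ltac:(split; simpl; auto_derive; auto; ring) ltac:(apply C_eq; simpl; ring))).
    apply is_derive_unique. unfold branch_sqr_modulus; simpl Re; simpl Im.
    auto_derive.
    - rewrite !Rplus_0_r. repeat split; simpl in P1, P2; lra.
    - rewrite !Rplus_0_r. simpl in P1, P2.
      unfold log_derivative, Re, Im in *; simpl; unfold Rminus in *; field; lra. }
  rewrite <- (branch_value_sqr_modulus a b al z (Phi z) (Hv z Hz)) in Ex, Ey.
  set (L := log_derivative a b al z) in *.
  assert (Hp : Re (Phi z) ^ 2 + Im (Phi z) ^ 2 <> 0).
  { intros E. apply Hn, C_eq; simpl; nra. }
  destruct (Phi z) as [x y], l as [u v], L as [p q].
  unfold Re, Im in *; simpl in *.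
  (* real and imaginary part of conj (Phi z) * l = |Phi z|^2 * L *)
  assert (F1 : x * u + y * v = (x ^ 2 + y ^ 2) * p) by lra.
  assert (F2 : x * v - y * u = (x ^ 2 + y ^ 2) * q) by lra.
  apply C_eq; simpl; apply (Rmult_eq_reg_l (x ^ 2 + y ^ 2)); simpl; try lra.
  - transitivity (x * (x * u + y * v) - y * (x * v - y * u)); [ring|].
    rewrite F1, F2; ring.
  - transitivity (x * (x * v - y * u) + y * (x * u + y * v)); [ring|].
    rewrite F1, F2; ring.
Qed.

(** * Integrals along piecewise smooth paths *)

(** Tested on curves, a primitive of a product can be checked with the product
rule [curve_derive_mult] for functions of a real variable. *)
Definition curve_primitive (U : C -> Prop) (F f : C -> C) : Prop :=
  forall (h : R -> C) (t : R) (d : C),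
    U (h t) -> curve_derive h t d ->
    curve_derive (fun u => F (h u)) t (f (h t) * d)%C.

Lemma is_derive_curve_primitive (U : C -> Prop) (F f : C -> C) :
  (forall z, U z -> is_derive (K := C_AbsRing) (V := C_NormedModule) F z (f z)) ->
  curve_primitive U F f.
Proof. intros HF h t d Hu Hh. apply curve_derive_holomorphic; auto. Qed.

(** Only inside the arc: at the knots of the subdivision the contour may have a
corner, where [path_derive] has no meaning. *)
Lemma path_derive_arc (g h dh : R -> C) (a b : R) :
  (forall t, a <= t <= b -> g t = h t) ->
  (forall t, is_derive (V := C_R_NormedModule) h t (dh t)) ->
  forall t, a < t < b -> path_derive g t = dh t.
Proof.
  intros Hg Hh t Ht. destruct (is_derive_curve h t (dh t) (Hh t)) as [D1 D2].
  assert (Hl : locally t (fun u => a <= u <= b)).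
  { apply (filter_imp (fun u => a < u < b)); [intros u; lra|].
    apply (open_and (fun u => a < u) (fun u => u < b));
      [apply open_gt | apply open_lt | exact Ht]. }
  unfold path_derive. apply C_eq; simpl; apply is_derive_unique;
  (eapply is_derive_ext_loc; [|eassumption]);
  revert Hl; apply filter_imp; intros u Hu; now rewrite Hg.
Qed.

Lemma subdivision_mono (N : nat) (s : nat -> R) :
  (forall i, (i < N)%nat -> s i < s (S i)) ->
  forall j i, (i <= j <= N)%nat -> s i <= s j.
Proof.
  intros Hs. induction j as [|j IH]; intros i Hi.
  - replace i with 0%nat by lia. lra.
  - destruct (Nat.eq_dec i (S j)) as [->|]; [lra|].
    apply Rle_trans with (s j); [apply IH; lia|]. left; apply Hs; lia.
Qed.

(** A statement about the portion of a contour up to the parameter [x] can be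
proved by adding one smooth arc after the other. *)
Lemma contour_induction (g : R -> C) (Q : R -> Prop) :
  piecewise_C1 g -> Q 0 ->
  (forall a b h dh, 0 <= a < b -> b <= 1 ->
     (forall t, curve_derive h t (dh t)) ->
     (forall t, continuous (U := C_UniformSpace) dh t) ->
     (forall t, a <= t <= b -> g t = h t) ->
     (forall t, a < t < b -> path_derive g t = dh t) ->
     Q a -> Q b) ->
  Q 1.
Proof.
  intros (N & s & H0 & H1 & Hs & Hp) Q0 Hstep.
  assert (HQ : forall k, (k <= N)%nat -> Q (s k)).
  { induction k as [|k IH]; intros Hk; [now rewrite H0|].
    destruct (Hp k Hk) as (h & dh & Hh & Hc & Hg).
    apply (Hstep (s k) (s (S k)) h dh).
    - split; [rewrite <- H0; apply (subdivision_mono N s Hs); lia | now apply Hs].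
    - rewrite <- H1. apply (subdivision_mono N s Hs); lia.
    - intros t; apply is_derive_curve, Hh.
    - exact Hc.
    - exact Hg.
    - exact (path_derive_arc _ _ _ _ _ Hg Hh).
    - apply IH; lia. }
  rewrite <- H1. apply HQ; lia.
Qed.

Lemma is_RInt_arc (g h dh : R -> C) (f : C -> C) (a b : R) l :
  a < b ->
  (forall t, a <= t <= b -> g t = h t) ->
  (forall t, a < t < b -> path_derive g t = dh t) ->
  is_RInt (V := C_R_NormedModule) (fun t => f (h t) * dh t)%C a b l ->
  is_RInt (V := C_R_NormedModule) (fun t => f (g t) * path_derive g t)%C a b l.
Proof.
  intros Hab Hg Hd. apply (is_RInt_ext (V := C_R_NormedModule)).
  rewrite Rmin_left, Rmax_right by lra. intros t Ht. rewrite Hd, Hg by lra. reflexivity.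
Qed.

Lemma is_RInt_path_primitive (g : R -> C) (U : C -> Prop) (F f : C -> C) :
  piecewise_C1 g ->
  (forall t, 0 <= t <= 1 -> U (g t)) ->
  curve_primitive U F f ->
  (forall z, U z -> Ccontinuous f z) ->
  is_RInt (V := C_R_NormedModule) (fun t => f (g t) * path_derive g t)%C 0 1
    (F (g 1) - F (g 0))%C.
Proof.
  intros Hg HU HF Hf.
  apply (contour_induction g (fun x => is_RInt (V := C_R_NormedModule)
    (fun t => f (g t) * path_derive g t)%C 0 x (F (g x) - F (g 0))%C) Hg).
  - replace (F (g 0) - F (g 0))%C with (zero : C_R_NormedModule) by (symmetry; apply Cplus_opp_r).
    apply is_RInt_point.
  - intros a b h dh Hab Hb Hh Hc Eg Ed Ha.
    replace (F (g b) - F (g 0))%C with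
      (plus (G := C_R_NormedModule) (F (g a) - F (g 0))%C (F (h b) - F (h a))%C).
    2: { rewrite (Eg a), (Eg b) by lra.
    change ((F (h a) - F (g 0)) + (F (h b) - F (h a)) = F (h b) - F (g 0))%C. ring. }
    apply (is_RInt_Chasles (V := C_R_NormedModule)) with a; [exact Ha|].
    apply (is_RInt_arc _ h dh); [lra | exact Eg | exact Ed |].
    apply (is_RInt_curve (fun t => F (h t))); rewrite Rmin_left, Rmax_right by lra; intros t Ht.
    + apply HF; [rewrite <- Eg by lra; apply HU; lra | apply Hh].
    + apply continuous_Cmult; [|apply Hc].
      apply (continuous_comp (V := C_UniformSpace)).
      * eapply curve_derive_continuous, Hh.
      * apply Hf. rewrite <- Eg by lra; apply HU; lra.
Qed.

Lemma ex_RInt_arc (h dh : R -> C) (f : C -> C) (a b : R) :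
  a < b ->
  (forall t, curve_derive h t (dh t)) ->
  (forall t, continuous (U := C_UniformSpace) dh t) ->
  (forall t, a <= t <= b -> Ccontinuous f (h t)) ->
  ex_RInt (V := C_R_NormedModule) (fun t => f (h t) * dh t)%C a b.
Proof.
  intros Hab Hh Hc Hf.
  apply (ex_RInt_continuous (V := C_R_CompleteNormedModule)).
  rewrite Rmin_left, Rmax_right by lra. intros t Ht.
  apply continuous_Cmult; [|apply Hc].
  apply (continuous_comp (V := C_UniformSpace)).
  - eapply curve_derive_continuous, Hh.
  - now apply Hf.
Qed.

Lemma ex_RInt_path (g : R -> C) (f : C -> C) :
  piecewise_C1 g ->
  (forall t, 0 <= t <= 1 -> Ccontinuous f (g t)) ->
  ex_RInt (V := C_R_NormedModule) (fun t => f (g t) * path_derive g t)%C 0 1.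
Proof.
  intros Hg Hf.
  apply (contour_induction g (fun x => ex_RInt (V := C_R_NormedModule)
    (fun t => f (g t) * path_derive g t)%C 0 x) Hg).
  - apply ex_RInt_point.
  - intros a b h dh Hab Hb Hh Hc Eg Ed Ha.
    apply (ex_RInt_Chasles (V := C_R_NormedModule)) with a; [exact Ha|].
    destruct (ex_RInt_arc h dh f a b) as [l Hl]; try assumption; try lra.
    + intros t Ht. rewrite <- Eg by lra. apply Hf; lra.
    + exists l. apply (is_RInt_arc _ h dh); try assumption; lra.
Qed.

Lemma contour_integral_primitive (g : R -> C) (U : C -> Prop) (F f : C -> C) :
  piecewise_C1 g -> g 0 = g 1 ->
  (forall t, 0 <= t <= 1 -> U (g t)) ->
  curve_primitive U F f ->
  (forall z, U z -> Ccontinuous f z) ->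
  contour_integral f g = 0%C.
Proof.
  intros Hg E HU HF Hf.
  assert (HI := is_RInt_path_primitive g U F f Hg HU HF Hf).
  unfold contour_integral.
  rewrite (is_RInt_unique (V := C_R_CompleteNormedModule) _ _ _ _ HI), E. ring.
Qed.

(** * Dilating the integrand about a point of the cut *)

Notation CInt := (RInt (V := C_R_CompleteNormedModule)).

Lemma Re_RInt (f : R -> C) (a b : R) :
  ex_RInt (V := C_R_NormedModule) f a b -> Re (CInt f a b) = RInt (fun t => Re (f t)) a b.
Proof.
  intros Hf. symmetry. apply is_RInt_unique.
  apply (is_RInt_fct_extend_fst (U := R_NormedModule) (V := R_NormedModule) f).
  exact (RInt_correct (V := C_R_CompleteNormedModule) _ _ _ Hf).
Qed.

Lemma Im_RInt (f : R -> C) (a b : R) :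
  ex_RInt (V := C_R_NormedModule) f a b -> Im (CInt f a b) = RInt (fun t => Im (f t)) a b.
Proof.
  intros Hf. symmetry. apply is_RInt_unique.
  apply (is_RInt_fct_extend_snd (U := R_NormedModule) (V := R_NormedModule) f).
  exact (RInt_correct (V := C_R_CompleteNormedModule) _ _ _ Hf).
Qed.

(** The derivative is required for [t'] near each [t] of [a, b], endpoints
included, because joint continuity is a condition on a full neighbourhood. *)
Lemma is_derive_RInt_param_real (f df : R -> R -> R) (a b u : R) :
  a < b ->
  (forall t, a <= t <= b -> locally t
    (fun t' => forall v, is_derive (fun v => f v t') v (df v t'))) ->
  (forall t, a <= t <= b -> continuous (fun z : R * R => df (fst z) (snd z)) (u, t)) ->
  (forall v, ex_RInt (f v) a b) ->
  is_derive (fun v => RInt (f v) a b) u (RInt (df u) a b).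
Proof.
  intros Hab Hd Hc Hi.
  assert (E : RInt (df u) a b = RInt (fun t => Derive (fun v => f v t) u) a b).
  { apply RInt_ext. rewrite Rmin_left, Rmax_right by lra. intros t Ht.
    symmetry. apply is_derive_unique. apply (locally_singleton t _ (Hd t ltac:(lra))). }
  rewrite E. apply is_derive_RInt_param.
  - apply filter_forall. intros v. rewrite Rmin_left, Rmax_right by lra. intros t Ht.
    eexists. apply (locally_singleton t _ (Hd t Ht)).
  - rewrite Rmin_left, Rmax_right by lra. intros t Ht.
    apply (continuity_2d_pt_ext_loc df).
    + destruct (Hd t Ht) as [eps He]. exists eps. intros v t' _ Ht'.
      symmetry. apply is_derive_unique. apply He, Ht'.
    + apply continuity_2d_pt_filterlim. exact (Hc t Ht).
  - apply filter_forall. intros v. apply Hi.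
Qed.

Lemma curve_derive_RInt_param (phi psi : R -> R -> C) (a b u : R) :
  a < b ->
  (forall t, a <= t <= b -> locally t
    (fun t' => forall v, curve_derive (fun v => phi v t') v (psi v t'))) ->
  (forall t, a <= t <= b ->
    continuous (U := C_UniformSpace) (fun z : R * R => psi (fst z) (snd z)) (u, t)) ->
  (forall v, ex_RInt (V := C_R_NormedModule) (phi v) a b) ->
  curve_derive (fun v => CInt (phi v) a b) u (CInt (psi u) a b).
Proof.
  intros Hab Hd Hc Hi.
  assert (Hj : ex_RInt (V := C_R_NormedModule) (psi u) a b).
  { apply (ex_RInt_continuous (V := C_R_CompleteNormedModule)).
    rewrite Rmin_left, Rmax_right by lra. intros t Ht.
    apply (continuous_comp_2 (U := R_UniformSpace) (V := R_UniformSpace) (W := R_UniformSpace)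
      (X := C_UniformSpace) (fun _ => u) (fun t => t) psi).
    - apply continuous_const.
    - apply continuous_id.
    - apply (Hc t Ht). }
  split.
  - rewrite Re_RInt by exact Hj.
    apply (is_derive_ext (fun v => RInt (fun t => Re (phi v t)) a b)).
    { intros v. symmetry. apply Re_RInt, Hi. }
    apply (is_derive_RInt_param_real (fun v t => Re (phi v t)) (fun v t => Re (psi v t)));
      [exact Hab| | |].
    + intros t Ht. generalize (Hd t Ht). apply filter_imp. intros t' H' v. apply H'.
    + intros t Ht. apply (continuous_Re (fun z : R * R => psi (fst z) (snd z))). now apply Hc.
    + intros v. destruct (Hi v) as [l Hl]. exists (fst l).
      apply (is_RInt_fct_extend_fst (U := R_NormedModule) (V := R_NormedModule) (phi v)), Hl.
  - rewrite Im_RInt by exact Hj.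
    apply (is_derive_ext (fun v => RInt (fun t => Im (phi v t)) a b)).
    { intros v. symmetry. apply Im_RInt, Hi. }
    apply (is_derive_RInt_param_real (fun v t => Im (phi v t)) (fun v t => Im (psi v t)));
      [exact Hab| | |].
    + intros t Ht. generalize (Hd t Ht). apply filter_imp. intros t' H' v. apply H'.
    + intros t Ht. apply (continuous_Im (fun z : R * R => psi (fst z) (snd z))). now apply Hc.
    + intros v. destruct (Hi v) as [l Hl]. exists (snd l).
      apply (is_RInt_fct_extend_snd (U := R_NormedModule) (V := R_NormedModule) (phi v)), Hl.
Qed.

Definition dilate (c : C) (s : R) (z : C) : C := (c + RtoC s * (z - c))%C.

Lemma curve_derive_eq f t l l' : curve_derive f t l -> l = l' -> curve_derive f t l'.
Proof. now intros Hf <-. Qed.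

Lemma continuous_RtoC {T : UniformSpace} (f : T -> R) (x : T) :
  continuous f x -> continuous (U := C_UniformSpace) (fun y => RtoC (f y)) x.
Proof. intros Hf. apply continuous_C; simpl; [exact Hf | apply continuous_const]. Qed.

Lemma continuous_dilate {T : UniformSpace} (c : C) (s : T -> R) (z : T -> C) (x : T) :
  continuous s x -> continuous (U := C_UniformSpace) z x ->
  continuous (U := C_UniformSpace) (fun y => dilate c (s y) (z y)) x.
Proof.
  intros Hs Hz. unfold dilate, Cminus.
  apply continuous_Cplus; [apply (continuous_const (V := C_UniformSpace))|].
  apply continuous_Cmult; [now apply continuous_RtoC|].
  apply continuous_Cplus; [exact Hz | apply (continuous_const (V := C_UniformSpace))].
Qed.

Lemma curve_derive_dilate (c : C) (s : R -> R) (z : R -> C) (t ds : R) (dz : C) :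
  is_derive s t ds -> curve_derive z t dz ->
  curve_derive (fun u => dilate c (s u) (z u)) t (RtoC ds * (z t - c) + RtoC (s t) * dz)%C.
Proof.
  intros Hs Hz. unfold dilate, Cminus. eapply curve_derive_eq.
  - apply curve_derive_plus; [apply curve_derive_const|].
    apply curve_derive_mult; [apply curve_derive_RtoC, Hs|].
    apply curve_derive_plus; [exact Hz | apply curve_derive_const].
  - simpl. ring.
Qed.

(** The dilation factor [1 + u ^ 2] is at least 1 for all real [u], so every
value of the parameter is interior. *)
Definition dilated (c : C) (Phi : C -> C) (u : R) (z : C) : C :=
  (RtoC (1 + u ^ 2) * Phi (dilate c (1 + u ^ 2) z))%C.

Lemma is_derive_one_plus_sqr u : is_derive (fun u : R => 1 + u ^ 2) u (2 * u).
Proof. auto_derive; [auto | ring]. Qed.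

Lemma continuous_one_plus_sqr u : continuous (fun u : R => 1 + u ^ 2) u.
Proof. apply (ex_derive_continuous (V := R_NormedModule)).
eexists; apply is_derive_one_plus_sqr. Qed.

Section Dilation.

Variables (U : C -> Prop) (Phi dPhi : C -> C) (c : C).
Hypothesis HU : open (T := C_UniformSpace) U.
Hypothesis Hstar : forall z s, U z -> 1 <= s -> U (dilate c s z).
Hypothesis HPhi : curve_primitive U Phi dPhi.
Hypothesis CPhi : forall z, U z -> Ccontinuous Phi z.
Hypothesis CdPhi : forall z, U z -> Ccontinuous dPhi z.

Lemma domain_dilate z u : U z -> U (dilate c (1 + u ^ 2) z).
Proof. intros Hz. apply Hstar; [exact Hz|]. generalize (pow2_ge_0 u); lra. Qed.

Lemma continuous_dilated z u : U z ->
  Ccontinuous (dilated c Phi u) z.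
Proof.
  intros Hz. apply continuous_Cmult; [apply (continuous_const (V := C_UniformSpace))|].
  apply (continuous_comp (V := C_UniformSpace) (dilate c (1 + u ^ 2))).
  - apply continuous_dilate; [apply continuous_const | apply continuous_id].
  - apply CPhi, domain_dilate, Hz.
Qed.

(** The derivative of [dilated] in the parameter is exact in [z]: for the factor
s = 1 + u^2, d/ds (s Phi(c + s (z - c))) = d/dz ((z - c) Phi(c + s (z - c))).
This is the primitive, multiplied by ds/du. *)
Definition dilated_flux (u : R) (z : C) : C :=
  (RtoC (2 * u) * ((z - c) * Phi (dilate c (1 + u ^ 2) z)))%C.

Definition dilated_rate (u : R) (z : C) : C :=
  (RtoC (2 * u) * (Phi (dilate c (1 + u ^ 2) z)
     + RtoC (1 + u ^ 2) * (z - c) * dPhi (dilate c (1 + u ^ 2) z)))%C.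

Lemma curve_derive_dilated z u : U z ->
  curve_derive (fun v => dilated c Phi v z) u (dilated_rate u z).
Proof.
  intros Hz. unfold dilated. eapply curve_derive_eq.
  - apply curve_derive_mult; [apply curve_derive_RtoC, is_derive_one_plus_sqr|].
    apply (HPhi (fun v => dilate c (1 + v ^ 2) z) u); [now apply domain_dilate|].
    apply (curve_derive_dilate c (fun v => 1 + v ^ 2) (fun _ => z)).
    + apply is_derive_one_plus_sqr.
    + apply curve_derive_const.
  - unfold dilated_rate. simpl. ring.
Qed.

Lemma curve_primitive_flux u : curve_primitive U (dilated_flux u) (dilated_rate u).
Proof.
  intros h t d Hh Hd. unfold dilated_flux. eapply curve_derive_eq.
  - apply curve_derive_mult; [apply curve_derive_const|].
    apply curve_derive_mult; [apply curve_derive_plus; [exact Hd | apply curve_derive_const]|].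
    apply (HPhi (fun t => dilate c (1 + u ^ 2) (h t)) t); [now apply domain_dilate|].
    apply (curve_derive_dilate c (fun _ => 1 + u ^ 2)); [apply is_derive_const | exact Hd].
  - unfold dilated_rate. simpl. change (@zero R_NormedModule) with 0. ring.
Qed.

Lemma continuous_dilated_rate {T : UniformSpace} (u : T -> R) (z : T -> C) (x : T) :
  U (z x) -> continuous u x -> continuous (U := C_UniformSpace) z x ->
  continuous (U := C_UniformSpace) (fun y => dilated_rate (u y) (z y)) x.
Proof.
  intros Hx Hu Hz.
  assert (Hs : continuous (fun y => 1 + u y ^ 2) x).
  { apply (continuous_comp u (fun v => 1 + v ^ 2)); [exact Hu | apply continuous_one_plus_sqr]. }
  assert (Hw : continuous (U := C_UniformSpace) (fun y => dilate c (1 + u y ^ 2) (z y)) x)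
    by now apply (continuous_dilate c (fun y => 1 + u y ^ 2)).
  unfold dilated_rate, Cminus. apply continuous_Cmult.
  { apply continuous_RtoC.
    apply (continuous_mult (K := R_AbsRing)); [apply continuous_const | exact Hu]. }
  apply continuous_Cplus; [|apply continuous_Cmult; [apply continuous_Cmult|]].
  - apply (continuous_comp (V := C_UniformSpace) (fun y => dilate c (1 + u y ^ 2) (z y)));
      [exact Hw | apply CPhi, domain_dilate, Hx].
  - now apply continuous_RtoC.
  - apply continuous_Cplus; [exact Hz | apply (continuous_const (V := C_UniformSpace))].
  - apply (continuous_comp (V := C_UniformSpace) (fun y => dilate c (1 + u y ^ 2) (z y)));
      [exact Hw | apply CdPhi, domain_dilate, Hx].
Qed.

(** Differentiation under the integral sign turns the integrand into the
derivative of the flux, so only the endpoints of the arc contribute. *)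
Lemma curve_derive_dilated_arc (h dh : R -> C) (a b u : R) :
  a < b ->
  (forall t, curve_derive h t (dh t)) ->
  (forall t, continuous (U := C_UniformSpace) dh t) ->
  (forall t, a <= t <= b -> U (h t)) ->
  curve_derive (fun v => CInt (fun t => dilated c Phi v (h t) * dh t)%C a b) u
    (dilated_flux u (h b) - dilated_flux u (h a))%C.
Proof.
  intros Hab Hh Hc Hu.
  assert (Ch : forall t, continuous (U := C_UniformSpace) h t).
  { intros t. eapply curve_derive_continuous, Hh. }
  eapply curve_derive_eq.
  - apply (curve_derive_RInt_param (fun v t => dilated c Phi v (h t) * dh t)%C
      (fun v t => dilated_rate v (h t) * dh t)%C); [exact Hab| | |].
    + intros t Ht. generalize (Ch t _ (HU _ (Hu t Ht))); unfold filtermap; apply filter_imp.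
      intros t' Ht' v. eapply curve_derive_eq.
      * apply (curve_derive_mult (fun v => dilated c Phi v (h t')) (fun _ => dh t'));
          [apply curve_derive_dilated, Ht' | apply curve_derive_const].
      * ring.
    + intros t Ht. apply continuous_Cmult.
      * apply (continuous_dilated_rate (T := prod_UniformSpace R_UniformSpace R_UniformSpace)
          fst (fun z => h (snd z)) (u, t)).
        -- now apply Hu.
        -- apply continuous_fst.
        -- apply (continuous_comp (U := prod_UniformSpace R_UniformSpace R_UniformSpace)
             (W := C_UniformSpace) snd h); [apply continuous_snd | apply Ch].
      * apply (continuous_comp (U := prod_UniformSpace R_UniformSpace R_UniformSpace)
          (W := C_UniformSpace) snd dh); [apply continuous_snd | apply Hc].
    + intros v. apply ex_RInt_arc; try assumption.
      intros t Ht. now apply continuous_dilated, Hu.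
  - apply (is_RInt_unique (V := C_R_CompleteNormedModule)).
    apply (is_RInt_curve (fun t => dilated_flux u (h t))); rewrite Rmin_left, Rmax_right by lra;
      intros t Ht.
    + apply curve_primitive_flux; [now apply Hu | apply Hh].
    + apply continuous_Cmult; [|apply Hc].
      apply (continuous_dilated_rate (fun _ => u) h);
        [now apply Hu | apply continuous_const | apply Ch].
Qed.

Lemma curve_derive_dilated_path (g : R -> C) (u : R) :
  piecewise_C1 g -> (forall t, 0 <= t <= 1 -> U (g t)) ->
  curve_derive (fun v => contour_integral (dilated c Phi v) g) u
    (dilated_flux u (g 1) - dilated_flux u (g 0))%C.
Proof.
  intros Hg Hu.
  apply (contour_induction g (fun x =>
    (forall v, ex_RInt (V := C_R_NormedModule)
      (fun t => dilated c Phi v (g t) * path_derive g t)%C 0 x) /\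
    curve_derive (fun v => CInt (fun t => dilated c Phi v (g t) * path_derive g t)%C 0 x) u
      (dilated_flux u (g x) - dilated_flux u (g 0))%C) Hg).
  - split; [intros v; apply ex_RInt_point|].
    apply (curve_derive_ext (fun _ => 0%C) _ u 0%C).
    + intros v. symmetry. apply (RInt_point (V := C_R_CompleteNormedModule)).
    + ring.
    + apply curve_derive_const.
  - intros a b h dh Hab Hb Hh Hc Eg Ed [Hex Hd].
    assert (Hi : forall v, ex_RInt (V := C_R_NormedModule)
      (fun t => dilated c Phi v (h t) * dh t)%C a b).
    { intros v. apply ex_RInt_arc; try assumption; try lra.
      intros t Ht. apply continuous_dilated. rewrite <- Eg by lra. apply Hu; lra. }
    assert (Hj : forall v, is_RInt (V := C_R_NormedModule)
      (fun t => dilated c Phi v (g t) * path_derive g t)%C a b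
      (CInt (fun t => dilated c Phi v (h t) * dh t)%C a b)).
    { intros v. apply (is_RInt_arc g h dh); [lra | exact Eg | exact Ed |].
      exact (RInt_correct (V := C_R_CompleteNormedModule) _ _ _ (Hi v)). }
    assert (Hk : forall v, is_RInt (V := C_R_NormedModule)
      (fun t => dilated c Phi v (g t) * path_derive g t)%C 0 b
      (CInt (fun t => dilated c Phi v (g t) * path_derive g t)%C 0 a
        + CInt (fun t => dilated c Phi v (h t) * dh t)%C a b)%C).
    { intros v. apply (is_RInt_Chasles (V := C_R_NormedModule)) with a; [|apply Hj].
      exact (RInt_correct (V := C_R_CompleteNormedModule) _ _ _ (Hex v)). }
    split; [intros v; eexists; apply Hk|].
    apply (curve_derive_ext (fun v =>
      (CInt (fun t => dilated c Phi v (g t) * path_derive g t)%C 0 a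
        + CInt (fun t => dilated c Phi v (h t) * dh t)%C a b)%C) _ u
       ((dilated_flux u (g a) - dilated_flux u (g 0)) +
         (dilated_flux u (h b) - dilated_flux u (h a)))%C).
    + intros v. symmetry. apply (is_RInt_unique (V := C_R_CompleteNormedModule)), Hk.
    + rewrite (Eg a), (Eg b) by lra. ring.
    + apply curve_derive_plus; [exact Hd|].
      apply curve_derive_dilated_arc; try assumption; try lra.
      intros t Ht. rewrite <- Eg by lra. apply Hu; lra.
Qed.

(** On a closed contour the endpoint contributions of the flux cancel, so the
integral does not depend on the dilation. *)
Lemma contour_integral_dilated (g : R -> C) (u : R) :
  0 < u -> piecewise_C1 g -> g 0 = g 1 -> (forall t, 0 <= t <= 1 -> U (g t)) ->
  contour_integral (dilated c Phi u) g = contour_integral Phi g.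
Proof.
  intros H0 Hg E Hu.
  assert (HD : forall v, curve_derive (fun v => contour_integral (dilated c Phi v) g) v 0%C).
  { intros v. eapply curve_derive_eq; [now apply curve_derive_dilated_path|].
    rewrite E. ring. }
  transitivity (contour_integral (dilated c Phi 0) g).
  - apply C_eq.
    + symmetry. apply (eq_is_derive (V := R_NormedModule)
        (fun v => Re (contour_integral (dilated c Phi v) g)) 0 u); [|exact H0].
      intros v _. apply HD.
    + symmetry. apply (eq_is_derive (V := R_NormedModule)
        (fun v => Im (contour_integral (dilated c Phi v) g)) 0 u); [|exact H0].
      intros v _. apply HD.
  - unfold contour_integral. apply (RInt_ext (V := C_R_CompleteNormedModule)).
    intros t _. unfold dilated, dilate.
    replace (1 + 0 ^ 2) with 1 by ring.
    replace (c + 1 * (g t - c))%C with (g t) by ring.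
    change (1 * Phi (g t) * path_derive g t = Phi (g t) * path_derive g t)%C. ring.
Qed.
End Dilation.

(** * The limit of infinite dilation *)

Lemma continuous_Cmod {T : UniformSpace} (f : T -> C) (x : T) :
  continuous (U := C_UniformSpace) f x -> continuous (fun y => Cmod (f y)) x.
Proof.
  intros Hf. apply (continuous_comp (fun y => Re (f y) ^ 2 + Im (f y) ^ 2) sqrt).
  - now apply continuous_sqr_modulus.
  - apply continuous_sqrt.
Qed.

Lemma bounded_on_segment (f : R -> R) (a b : R) :
  a <= b -> (forall t, a <= t <= b -> continuous f t) ->
  exists B, 0 < B /\ forall t, a <= t <= b -> f t <= B.
Proof.
  intros Hab Hf.
  destruct (continuity_ab_maj f a b Hab) as [x [Hx _]].
  { intros t Ht. apply continuity_pt_filterlim, Hf, Ht. }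
  exists (Rmax 1 (f x)). split.
  - apply Rlt_le_trans with 1; [lra | apply Rmax_l].
  - intros t Ht. apply Rle_trans with (f x); [now apply Hx | apply Rmax_r].
Qed.

Lemma is_RInt_Cscal (k : C) (f : R -> C) (a b : R) (l : C) :
  is_RInt (V := C_R_NormedModule) f a b l ->
  is_RInt (V := C_R_NormedModule) (fun t => k * f t)%C a b (k * l)%C.
Proof.
  intros Hf.
  assert (H1 := is_RInt_fct_extend_fst (U := R_NormedModule) (V := R_NormedModule) f _ _ _ Hf).
  assert (H2 := is_RInt_fct_extend_snd (U := R_NormedModule) (V := R_NormedModule) f _ _ _ Hf).
  apply (is_RInt_fct_extend_pair (U := R_NormedModule) (V := R_NormedModule)
    (fun t => k * f t)%C).
  - apply (is_RInt_minus (V := R_NormedModule)); now apply (is_RInt_scal (V := R_NormedModule)).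
  - apply (is_RInt_plus (V := R_NormedModule)); now apply (is_RInt_scal (V := R_NormedModule)).
Qed.

(** The asymptotic relation E Phi(z) ~ 1/z is the same as E Phi(z) ~ 1/(z - c),
in the form in which a dilation about [c] uses it. *)
Lemma asymptotic_recenter (E c : C) (Phi : C -> C) :
  (forall eps : posreal, exists A : R, forall z : C,
    A < Cmod z -> Cmod (E * Phi z / (1 / z) - 1) < eps) ->
  forall eps, 0 < eps -> exists A : R, 0 < A /\ forall z : C,
    A < Cmod z -> Cmod (E * Phi z * (z - c) - 1) <= eps.
Proof.
  intros Hinf eps He.
  assert (He' : 0 < Rmin (eps / 2) 1) by (apply Rmin_pos; lra).
  destruct (Hinf (mkposreal _ He')) as [A HA]. simpl in HA.
  assert (Hc := Cmod_ge_0 c).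
  exists (Rmax A (Rmax 1 (4 * Cmod c / eps))). split.
  { apply Rlt_le_trans with 1; [lra|]. eapply Rle_trans; [apply Rmax_l | apply Rmax_r]. }
  intros z Hz.
  assert (Hz1 : A < Cmod z) by (eapply Rle_lt_trans; [apply Rmax_l | exact Hz]).
  assert (Hz2 : Rmax 1 (4 * Cmod c / eps) < Cmod z)
    by (eapply Rle_lt_trans; [apply Rmax_r | exact Hz]).
  assert (Hz3 : 1 < Cmod z) by (eapply Rle_lt_trans; [apply Rmax_l | exact Hz2]).
  assert (Hz4 : 4 * Cmod c / eps < Cmod z) by (eapply Rle_lt_trans; [apply Rmax_r | exact Hz2]).
  assert (Hn : z <> 0%C) by (apply Cmod_gt_0; lra).
  specialize (HA z Hz1).
  replace (E * Phi z / (1 / z))%C with (E * Phi z * z)%C in HA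
    by (field; exact Hn).
  set (q := (E * Phi z * z - 1)%C) in HA.
  assert (Hq1 : Cmod q < eps / 2) by (eapply Rlt_le_trans; [exact HA | apply Rmin_l]).
  assert (Hq2 : Cmod q < 1) by (eapply Rlt_le_trans; [exact HA | apply Rmin_r]).
  replace (E * Phi z * (z - c) - 1)%C with (q - (q + 1) * (c / z))%C
    by (unfold q; field; exact Hn).
  assert (H1 : Cmod (q - (q + 1) * (c / z))%C <= Cmod q + Cmod ((q + 1) * (c / z))%C).
  { unfold Cminus. eapply Rle_trans; [apply Cmod_triangle|]. rewrite Cmod_opp; lra. }
  assert (H2 : Cmod (q + 1)%C <= 2).
  { eapply Rle_trans; [apply Cmod_triangle|]. rewrite Cmod_1; lra. }
  assert (H3 : Cmod (c / z)%C <= eps / 4).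
  { rewrite Cmod_div by exact Hn. apply Rle_div_l; [lra|].
    apply Rlt_le in Hz4. apply Rle_div_l in Hz4; [|lra]. lra. }
  rewrite Cmod_mult in H1.
  assert (Cmod (q + 1)%C * Cmod (c / z)%C <= 2 * (eps / 4)).
  { apply Rmult_le_compat; auto using Cmod_ge_0. }
  lra.
Qed.

(** For w = c + s (z - c) one has s Phi(w) = (w - c) Phi(w) / (z - c), and the
numerator tends to 1/E uniformly on each arc, where |z - c| is bounded below. *)
Lemma contour_integral_dilated_limit (E c : C) (Phi : C -> C) (g : R -> C) (U : C -> Prop) :
  piecewise_C1 g -> (forall t, 0 <= t <= 1 -> U (g t)) ->
  (forall z, U z -> (z - c)%C <> 0%C) ->
  (forall u z, U z -> Ccontinuous (dilated c Phi u) z) ->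
  (forall eps : posreal, exists A : R, forall z : C,
    A < Cmod z -> Cmod (E * Phi z / (1 / z) - 1) < eps) ->
  forall eps, 0 < eps -> exists A, forall u, A < u ->
    Cmod (E * contour_integral (dilated c Phi u) g - contour_integral (fun z => / (z - c))%C
      g)%C <= eps.
Proof.
  intros Hg Hu Hne HPhi Hinf.
  assert (Cinv_c : forall z, U z -> Ccontinuous (fun z => / (z - c))%C z).
  { intros z Hz. apply (continuous_Cinv (fun z => z - c)%C); [now apply Hne|].
    apply continuous_Cplus; [apply continuous_id | apply
      (continuous_const (V := C_UniformSpace))]. }
  pose (f := fun u z => (E * dilated c Phi u z - / (z - c))%C).
  assert (Cf : forall u z, U z -> Ccontinuous (f u) z).
  { intros u z Hz. unfold f, Cminus. apply continuous_Cplus.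
    - apply continuous_Cmult; [apply (continuous_const (V := C_UniformSpace)) | now apply HPhi].
    - apply (continuous_opp (K := C_AbsRing) (V := C_NormedModule)). now apply Cinv_c. }
  enough (Hf : forall eps, 0 < eps -> exists A, forall u, A < u ->
     Cmod (CInt (fun t => f u (g t) * path_derive g t)%C 0 1) <= eps).
  { intros eps He. destruct (Hf eps He) as [A HA]. exists A. intros u Hau.
    specialize (HA u Hau).
    assert (I1 := RInt_correct (V := C_R_CompleteNormedModule) _ _ _
      (ex_RInt_path g _ Hg (fun t Ht => HPhi u (g t) (Hu t Ht)))).
    assert (I2 := RInt_correct (V := C_R_CompleteNormedModule) _ _ _
      (ex_RInt_path g _ Hg (fun t Ht => Cinv_c (g t) (Hu t Ht)))).
    replace (E * contour_integral (dilated c Phi u) g - contour_integral (fun z => / (z - c)) g)%C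
      with (CInt (fun t => f u (g t) * path_derive g t)%C 0 1); [exact HA|].
    apply (is_RInt_unique (V := C_R_CompleteNormedModule)).
    apply (is_RInt_ext (V := C_R_NormedModule) (fun t => minus (G := C_R_NormedModule)
      (E * (dilated c Phi u (g t) * path_derive g t))%C (/ (g t - c) * path_derive g t)%C)).
    { intros t _. change (E * (dilated c Phi u (g t) * path_derive g t) - / (g t - c) *
        path_derive g t
        = f u (g t) * path_derive g t)%C. unfold f; ring. }
    apply (is_RInt_minus (V := C_R_NormedModule)); [|exact I2].
    exact (is_RInt_Cscal E _ 0 1 _ I1). }
  assert (Hex : forall u x, 0 <= x <= 1 ->
    ex_RInt (V := C_R_NormedModule) (fun t => f u (g t) * path_derive g t)%C 0 x).
  { intros u x Hx. apply (ex_RInt_Chasles_1 (V := C_R_CompleteNormedModule)) with 1; [exact Hx|].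
    apply ex_RInt_path; [exact Hg|]. intros t Ht. now apply Cf, Hu. }
  apply (contour_induction g (fun x => forall eps, 0 < eps -> exists A, forall u, A < u ->
     Cmod (CInt (fun t => f u (g t) * path_derive g t)%C 0 x) <= eps) Hg).
  - intros eps He. exists 0. intros u _.
    rewrite (RInt_point (V := C_R_CompleteNormedModule)).
    change (Cmod 0 <= eps). rewrite Cmod_0; lra.
  - intros a b h dh Hab Hb Hh Hc Eg Ed Ha eps He.
    assert (Hn : forall t, a <= t <= b -> (h t - c)%C <> 0%C).
    { intros t Ht. apply Hne. rewrite <- Eg by lra. apply Hu; lra. }
    assert (Ch : forall t, a <= t <= b ->
      continuous (U := C_UniformSpace) (fun t => / (h t - c))%C t).
    { intros t Ht. apply continuous_Cinv; [now apply Hn|].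
      apply continuous_Cplus; [eapply curve_derive_continuous,
        Hh | apply (continuous_const (V := C_UniformSpace))]. }
    destruct (bounded_on_segment (fun t => Cmod (/ (h t - c))) a b) as [B1 [HB1 B1le]];
      [lra | intros t Ht; now apply continuous_Cmod, Ch |].
    destruct (bounded_on_segment (fun t => Cmod (dh t)) a b) as [B2 [HB2 B2le]];
      [lra | intros t Ht; now apply continuous_Cmod |].
    destruct (Ha (eps / 2)) as [A1 HA1]; [lra|].
    pose (e := eps / 2 / (B1 * B2 * (b - a))).
    assert (HBB : 0 < B1 * B2 * (b - a)) by (repeat apply Rmult_lt_0_compat; lra).
    assert (Hepos : 0 < e) by (apply Rdiv_lt_0_compat; lra).
    destruct (asymptotic_recenter E c Phi Hinf e Hepos) as [A2 [HA2 HA]].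
    (* B1 bounds 1 / |h - c|, so |w| >= u / B1 - |c| > A2 once u > B1 (A2 + |c|) *)
    exists (Rmax A1 (Rmax 1 (B1 * (A2 + Cmod c)))). intros u Hu'.
    assert (Hu1 : A1 < u) by (eapply Rle_lt_trans; [apply Rmax_l | exact Hu']).
    assert (Hu2 : Rmax 1 (B1 * (A2 + Cmod c)) < u)
      by (eapply Rle_lt_trans; [apply Rmax_r | exact Hu']).
    assert (Hu3 : 1 < u) by (eapply Rle_lt_trans; [apply Rmax_l | exact Hu2]).
    assert (Hu4 : B1 * (A2 + Cmod c) < u) by (eapply Rle_lt_trans; [apply Rmax_r | exact Hu2]).
    assert (Hi : ex_RInt (V := C_R_NormedModule) (fun t => f u (h t) * dh t)%C a b).
    { apply ex_RInt_arc; try assumption; try lra. intros t Ht. apply Cf.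
      rewrite <- Eg by lra. apply Hu; lra. }
    destruct Hi as [l Hl].
    assert (Hnorm : Cmod l <= eps / 2).
    { rewrite <- norm_Cmod.
      replace (eps / 2) with ((b - a) * (e * B1 * B2)) by (unfold e; field; lra).
      apply (norm_RInt_le_const (V := C_R_NormedModule) (fun t => f u (h t) * dh t)%C a b l);
        [lra| |exact Hl].
      intros t Ht. rewrite norm_Cmod, Cmod_mult.
      apply Rmult_le_compat; auto using Cmod_ge_0.
      set (w := dilate c (1 + u ^ 2) (h t)).
      assert (Ew : f u (h t) = ((E * Phi w * (w - c) - 1) * / (h t - c))%C).
      { unfold f, dilated. fold w. replace (w - c)%C with (RtoC (1 + u ^ 2) * (h t - c))%C
          by (unfold w, dilate; ring).
        field. now apply Hn. }
      rewrite Ew, Cmod_mult. apply Rmult_le_compat; auto using Cmod_ge_0.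
      apply HA.
      assert (Hw : Cmod (w - c) = (1 + u ^ 2) * Cmod (h t - c)).
      { unfold w, dilate. replace (c + RtoC (1 + u ^ 2) * (h t - c) - c)%C
          with (RtoC (1 + u ^ 2) * (h t - c))%C by ring.
        rewrite Cmod_mult, Cmod_R, Rabs_pos_eq; [reflexivity|]. generalize (pow2_ge_0 u); lra. }
      assert (Hw' : Cmod (w - c) <= Cmod w + Cmod c).
      { unfold Cminus. eapply Rle_trans; [apply Cmod_triangle|]. rewrite Cmod_opp; lra. }
      specialize (B1le t Ht). simpl in B1le. rewrite Cmod_inv in B1le by now apply Hn.
      assert (Hpos : 0 < Cmod (h t - c)) by (apply Cmod_gt_0; now apply Hn).
      assert (1 <= B1 * Cmod (h t - c)).
      { apply (Rmult_le_compat_r (Cmod (h t - c))) in B1le; [|lra].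
        rewrite Rinv_l in B1le by lra. exact B1le. }
      assert (u < 1 + u ^ 2) by nra.
      assert (B1 * (A2 + Cmod c) < B1 * ((1 + u ^ 2) * Cmod (h t - c))) by nra.
      apply Rmult_lt_reg_l in H1; lra. }
    rewrite <- (RInt_Chasles (V := C_R_CompleteNormedModule)
      (fun t => f u (g t) * path_derive g t)%C 0 a b).
    + rewrite (is_RInt_unique (V := C_R_CompleteNormedModule) _ a b l).
      * eapply Rle_trans; [apply Cmod_triangle|]. specialize (HA1 u Hu1). lra.
      * apply (is_RInt_arc g h dh); [lra | exact Eg | exact Ed | exact Hl].
    + apply Hex; lra.
    + exists l. apply (is_RInt_arc g h dh); [lra | exact Eg | exact Ed | exact Hl].
Qed.

(** * The contour integrals H *)

Lemma z_roots rho theta (Hrho : 0 < rho) (Htheta : 0 < theta) :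
  0 < z_minus rho theta < z_plus rho theta /\
  rho * (z_plus rho theta + z_minus rho theta) = 1 + rho + theta /\
  rho * (z_plus rho theta * z_minus rho theta) = 1.
Proof.
  unfold z_plus, z_minus.
  set (b := 1 + rho + theta).
  assert (Hd : 0 < b ^ 2 - 4 * rho).
  { replace (b ^ 2 - 4 * rho) with ((1 - rho) ^ 2 + theta ^ 2 + 2 * theta * (1 + rho))
      by (unfold b; ring).
    generalize (pow2_ge_0 (1 - rho)) (pow2_gt_0 theta ltac:(lra))
      (Rmult_lt_0_compat _ _ Htheta Hrho); lra. }
  assert (Hs := sqrt_lt_R0 _ Hd). assert (Hq := pow2_sqrt _ (Rlt_le _ _ Hd)).
  set (q := sqrt (b ^ 2 - 4 * rho)) in *.
  assert (Hqb : q < b) by (assert (0 < b) by (unfold b; lra); nra).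
  assert (Hi : 0 < 1 / (2 * rho)) by (apply Rdiv_lt_0_compat; lra).
  repeat split.
  - apply Rmult_lt_0_compat; lra.
  - apply Rmult_lt_compat_l; lra.
  - field; lra.
  - transitivity ((b ^ 2 - q ^ 2) / (4 * rho)); [field; lra|]. rewrite Hq. field; lra.
Qed.

Lemma alpha_eq rho theta : 0 < rho -> 0 < theta ->
  alpha rho theta * (z_plus rho theta - z_minus rho theta) = z_plus rho theta.
Proof.
  intros Hr Ht. destruct (z_roots rho theta Hr Ht) as [H _].
  unfold alpha. field; lra.
Qed.

Lemma alpha_gt_1 rho theta : 0 < rho -> 0 < theta -> 1 < alpha rho theta.
Proof.
  intros Hr Ht. destruct (z_roots rho theta Hr Ht) as [H _].
  assert (E := alpha_eq rho theta Hr Ht). nra.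
Qed.

(** A segment is star-shaped about its endpoint [a]. *)
Lemma off_segment_dilate (a b : R) z s :
  ~ on_segment a b z -> 1 <= s -> ~ on_segment a b (dilate (RtoC a) s z).
Proof.
  intros Hz Hs [H1 H2]. apply Hz.
  unfold dilate in *; simpl in *. unfold on_segment, Re, Im in *.
  destruct z as [x y]; simpl in *. split; nra.
Qed.

Lemma log_derivative_continuous a b al z : a <= b -> ~ on_segment a b z ->
  Ccontinuous (log_derivative a b al) z.
Proof.
  intros Hab Hz.
  assert (Hc : forall k : C, Ccontinuous (fun _ => k) z)
    by (intros; apply (continuous_const (V := C_UniformSpace))).
  assert (Hid : Ccontinuous (fun z => z) z)
    by apply continuous_id.
  assert (Hopp : Ccontinuous (fun z => - z)%C z)
    by (apply (continuous_opp (K := C_AbsRing) (V := C_NormedModule)); exact Hid).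
  unfold log_derivative, Cdiv. apply continuous_Cplus; apply continuous_Cmult; try apply Hc;
  apply continuous_Cinv; try (apply continuous_Cplus; auto).
  - intros E. apply (off_segment_ne a b b z ltac:(lra) Hz).
    replace (z - b)%C with (- (b - z))%C by ring. rewrite E. ring.
  - apply (off_segment_ne a b a z ltac:(lra) Hz).
Qed.

Section Contour.

Variables (rho theta : R) (Phi : C -> C) (g : R -> C).
Hypothesis Hrho : 0 < rho.
Hypothesis Htheta : 0 < theta.
Hypothesis HPhi : integrand_branch rho theta Phi.
Hypothesis Hg : encircles_counterclockwise g (z_minus rho theta) (z_plus rho theta).

Let U (z : C) := ~ on_segment (z_minus rho theta) (z_plus rho theta) z.
Let dPhi (z : C) :=
  (Phi z * log_derivative (z_minus rho theta) (z_plus rho theta) (alpha rho theta) z)%C.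

Lemma integrand_derive z : U z -> is_derive (K := C_AbsRing) (V := C_NormedModule) Phi z (dPhi z).
Proof.
  apply branch_derive; try apply HPhi.
  apply z_roots; assumption.
Qed.

Lemma integrand_continuous z : U z -> Ccontinuous Phi z.
Proof.
  intros Hz P HP. apply locally_C.
  apply (ex_derive_continuous (K := C_AbsRing) (V := C_NormedModule) Phi z); [|exact HP].
  eexists; now apply integrand_derive.
Qed.

(** By dilation about z_- the integral of [Phi] becomes that of 1 / (z - z_-),
which is 2 pi i because the contour winds once around z_-. *)
Lemma H_0 : H rho theta Phi g 0 = 1%C.
Proof.
  destruct Hg as (Hp & Hcl & Hoff & Hw).
  destruct (z_roots rho theta Hrho Htheta) as (Hz & _ & _).
  assert (HU : open (T := C_UniformSpace) U) by apply open_off_segment.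
  set (c := RtoC (z_minus rho theta)).
  assert (Hstar : forall z s, U z -> 1 <= s -> U (dilate c s z))
    by (intros; now apply off_segment_dilate).
  assert (HP : curve_primitive U Phi dPhi) by (apply is_derive_curve_primitive, integrand_derive).
  assert (Hd : forall z, U z -> Ccontinuous dPhi z).
  { intros z Hz'. apply continuous_Cmult; [now apply integrand_continuous|].
    apply log_derivative_continuous; [lra | exact Hz']. }
  set (E := Cexp (Ci * alpha rho theta * PI)).
  assert (EI : (E * contour_integral Phi g = contour_integral (fun z => / (z - c)) g)%C).
  { apply Ceq_minus. apply Cmod_eq_0. apply Rle_antisym; [|apply Cmod_ge_0].
    apply Rle_plus_epsilon. intros eps He. rewrite Rplus_0_l.
    destruct (contour_integral_dilated_limit E c Phi g U Hp Hoff) with (eps := eps) as [A HA].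
    - intros z Hz'. apply (off_segment_ne _ _ _ _ (conj (Rle_refl _) (Rlt_le _ _ (proj2 Hz)))
        Hz').
    - intros u z. apply (continuous_dilated U Phi c Hstar integrand_continuous).
    - apply HPhi.
    - exact He.
    - specialize (HA (Rmax A 0 + 1)).
      rewrite (contour_integral_dilated U Phi dPhi c) in HA; try assumption.
      + apply HA. generalize (Rmax_l A 0); lra.
      + apply integrand_continuous.
      + generalize (Rmax_r A 0); lra. }
  unfold H. fold E.
  replace (contour_integral (fun z => z ^ 0 * Phi z)%C g) with (contour_integral Phi g).
  2: { unfold contour_integral. apply (RInt_ext (V := C_R_CompleteNormedModule)).
       intros t _. change (Phi (g t) * path_derive g t = 1 * Phi (g t) * path_derive g t)%C.
       ring. }
  rewrite <- (Hw (z_minus rho theta)) by lra. fold c. rewrite <- EI.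
  unfold Cdiv. ring.
Qed.

(** The combination of moments is the integral of the derivative of
rho z^n (z - z_+) (z - z_-) Phi(z) over a closed contour. *)
Lemma contour_recurrence n :
  (RtoC (INR (S n) * rho) * contour_integral (fun z => z ^ (S n) * Phi z) g
   - RtoC (INR (S n) * (1 + rho + theta)) * contour_integral (fun z => z ^ n * Phi z) g
   + RtoC (INR n) * contour_integral (fun z => z ^ (n - 1) * Phi z) g = 0)%C.
Proof.
  destruct Hg as (Hp & Hcl & Hoff & Hw).
  destruct (z_roots rho theta Hrho Htheta) as (Hz & Hsum & Hprod).
  assert (Hal := alpha_eq rho theta Hrho Htheta).
  assert (Hk : forall k z, U z -> Ccontinuous (fun z => z ^ k * Phi z)%C z).
  { intros k z Hz'. apply continuous_Cmult; [|now apply integrand_continuous].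
    apply continuous_Cpow, continuous_id. }
  assert (HI : forall k, is_RInt (V := C_R_NormedModule)
     (fun t => g t ^ k * Phi (g t) * path_derive g t)%C 0 1
       (contour_integral (fun z => z ^ k * Phi z)%C g)).
  { intros k. apply (RInt_correct (V := C_R_CompleteNormedModule)).
    apply (ex_RInt_path g (fun z => z ^ k * Phi z)%C Hp). intros t Ht. now apply Hk, Hoff. }
  pose (f := fun z : C => (RtoC (INR (S n) * rho) * (z ^ (S n) * Phi z)
    - RtoC (INR (S n) * (1 + rho + theta)) * (z ^ n * Phi z) + RtoC (INR n) *
        (z ^ (n - 1) * Phi z))%C).
  pose (F := fun z : C => (RtoC rho *
    (z ^ n * ((z - z_plus rho theta) * ((z - z_minus rho theta) * Phi z))))%C).
  assert (H0 : contour_integral f g = 0%C).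
  { apply (contour_integral_primitive g U F f); try assumption.
    - intros h t d Hh Hd. unfold F, Cminus. eapply curve_derive_eq.
      + apply curve_derive_mult; [apply curve_derive_const|].
        apply curve_derive_mult; [apply curve_derive_pow, Hd|].
        apply curve_derive_mult; [apply curve_derive_plus;
          [exact Hd | apply curve_derive_const]|].
        apply curve_derive_mult; [apply curve_derive_plus;
          [exact Hd | apply curve_derive_const]|].
        apply curve_derive_holomorphic; [apply integrand_derive, Hh | exact Hd].
      + assert (N1 := off_segment_ne _ _ _ _ (conj (Rlt_le _ _ (proj2 Hz)) (Rle_refl _)) Hh).
        assert (N2 := off_segment_ne _ _ _ _ (conj (Rle_refl _) (Rlt_le _ _ (proj2 Hz))) Hh).
        assert (N3 : (z_plus rho theta - h t)%C <> 0%C).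
        { intros E. apply N1. replace (h t - z_plus rho theta)%C
            with (- (z_plus rho theta - h t))%C by ring.
          rewrite E; ring. }
        (* -alpha (z - z_-) + (alpha - 1) (z - z_+) = -z: the equation that determines alpha *)
        assert (HL : ((h t - z_plus rho theta) * ((h t - z_minus rho theta) *
          log_derivative (z_minus rho theta) (z_plus rho theta) (alpha rho theta) (h t))
          = - h t)%C).
        { transitivity (- h t + (z_plus rho theta - alpha rho theta *
            (z_plus rho theta - z_minus rho theta)))%C.
          - unfold log_derivative; field; split; assumption.
          - rewrite <- RtoC_minus, <- RtoC_mult, Hal. ring. }
        assert (Hprod' : (RtoC rho * (z_plus rho theta * z_minus rho theta) = 1)%C)
          by (rewrite <- !RtoC_mult, Hprod; reflexivity).
        unfold f, dPhi. rewrite <- Hsum, S_INR, !RtoC_mult, !RtoC_plus.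
        set (L := log_derivative _ _ _ _) in *. clearbody L.
        set (x := RtoC (z_plus rho theta)) in *. set (y := RtoC (z_minus rho theta)) in *.
        set (z := h t) in *. set (w := Phi z). set (r := RtoC rho) in *. set (m := RtoC (INR n)).
        transitivity (r * d * w * (m * z ^ (n - 1) * ((z - x) * (z - y))
          + z ^ n * ((z - y) + (z - x) + (z - x) * ((z - y) * L))))%C; [ring|].
        rewrite HL.
        transitivity (d * w * (((m + 1) * r * (z * z ^ n) - (m + 1) * (r * (x + y)) * z ^ n)
          + m * (r * (x * y)) * z ^ (n - 1)))%C; [|rewrite Hprod'; simpl Cpow; ring].
        unfold m. destruct n as [|k]; [simpl; ring|].
        replace (S k - 1)%nat with k by lia. simpl Cpow. ring.
    - intros z Hz'. unfold f, Cminus.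
      assert (Hc : forall k : C, Ccontinuous (fun _ => k) z)
        by (intros; apply (continuous_const (V := C_UniformSpace))).
      apply continuous_Cplus; [apply continuous_Cplus|].
      + apply continuous_Cmult; [apply Hc | now apply Hk].
      + apply (continuous_opp (K := C_AbsRing) (V := C_NormedModule)).
        apply continuous_Cmult; [apply Hc | now apply Hk].
      + apply continuous_Cmult; [apply Hc | now apply Hk]. }
  rewrite <- H0. symmetry. unfold contour_integral at 1.
  apply (is_RInt_unique (V := C_R_CompleteNormedModule)).
  eapply (is_RInt_ext (V := C_R_NormedModule)).
  2: { apply (is_RInt_plus (V := C_R_NormedModule));
    [apply (is_RInt_minus (V := C_R_NormedModule))|];
       apply is_RInt_Cscal, HI. }
  intros t _. unfold f.
  match goal with |- plus (minus ?a ?b) ?c = _ => change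
    (a - b + c = f (g t) * path_derive g t)%C end.
  unfold f. ring.
Qed.
End Contour.

(** * The real integrals G *)

(** The Laplace transform of the evolution operator, multiplied by [n + 1].  For
[n = 0] the truncated index [n - 1] has the coefficient 0. *)
Definition sojourn_op (rho theta : R) (x : nat -> R) (n : nat) : R :=
  INR (S n) * rho * x (S n) - INR (S n) * (1 + rho + theta) * x n + INR n * x (n - 1)%nat.

(** Neither a one-sided power at z_- nor a density at time 0 is differentiable
at the endpoint; continuity is enough there. *)
Lemma is_RInt_derive_interior (f df : R -> R) (a b : R) :
  a < b ->
  (forall t, a < t < b -> is_derive f t (df t)) ->
  (forall t, a <= t <= b -> continuous f t) ->
  (forall t, a <= t <= b -> continuous df t) ->
  is_RInt df a b (f b - f a).
Proof.
  intros Hab Hd Hf Hc.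
  pose (k := extension_C0 df a b).
  assert (Ck : forall t, continuous k t).
  { intros t. apply extension_C0_continuous; [simpl; lra|]. intros x H1 H2.
    apply Hc; simpl in *; lra. }
  assert (Ek : forall t, a <= t <= b -> k t = df t).
  { intros t Ht. apply extension_C0_ext; simpl; lra. }
  assert (Hk : forall t, is_derive (fun t => RInt k a t) t (k t)).
  { intros t. apply (is_derive_RInt (V := R_NormedModule) k (fun t => RInt k a t) a).
    - apply filter_forall. intros u. apply (RInt_correct (V := R_CompleteNormedModule)).
      apply (ex_RInt_continuous (V := R_CompleteNormedModule)). intros; apply Ck.
    - apply Ck. }
  destruct (MVT_gen (fun t => f t - RInt k a t) a b (fun _ => 0)) as (c & _ & E).
  - rewrite Rmin_left, Rmax_right by lra. intros t Ht.
    replace 0 with (minus (G := R_NormedModule) (df t) (k t)).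
    + apply (is_derive_minus (V := R_NormedModule)); [now apply Hd | apply Hk].
    + rewrite Ek by lra. apply (minus_eq_zero (G := R_NormedModule)).
  - rewrite Rmin_left, Rmax_right by lra. intros t Ht. apply continuity_pt_filterlim.
    apply (continuous_minus (V := R_NormedModule)); [now apply Hf|].
    apply (ex_derive_continuous (V := R_NormedModule)). eexists; apply Hk.
  - simpl in E. rewrite (RInt_point (V := R_CompleteNormedModule)) in E.
    change (@zero R_CompleteNormedModule) with 0 in E.
    apply (is_RInt_ext k).
    { rewrite Rmin_left, Rmax_right by lra. intros t Ht. apply Ek; lra. }
    replace (f b - f a) with (RInt k a b) by lra.
    apply (RInt_correct (V := R_CompleteNormedModule)),
      (ex_RInt_continuous (V := R_CompleteNormedModule)).
    intros; apply Ck.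
Qed.

(** The real power continued by 0, which is continuous at 0 for a positive
exponent, whereas [Rpower 0 y] is 1. *)
Definition pos_power (x y : R) : R := if Rle_dec x 0 then 0 else Rpower x y.

Lemma pos_power_pos x y : 0 < x -> pos_power x y = Rpower x y.
Proof. intros Hx. unfold pos_power. destruct (Rle_dec x 0); [lra | reflexivity]. Qed.

Lemma pos_power_nonpos x y : x <= 0 -> pos_power x y = 0.
Proof. intros Hx. unfold pos_power. destruct (Rle_dec x 0); [reflexivity | lra]. Qed.

Lemma is_derive_Rpower x y : 0 < x -> is_derive (fun x => Rpower x y) x (y * Rpower x (y - 1)).
Proof.
  intros Hx. unfold Rpower. auto_derive; [exact Hx|].
  replace ((y - 1) * ln x) with (y * ln x + - ln x) by ring.
  rewrite exp_plus, exp_Ropp, exp_ln by exact Hx. field; lra.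
Qed.

Lemma pos_power_continuous y x : 0 < y -> continuous (fun x => pos_power x y) x.
Proof.
  intros Hy. destruct (Rtotal_order x 0) as [Hx | [-> | Hx]].
  - apply (continuous_ext_loc _ (fun _ => 0)); [|apply continuous_const].
    generalize (open_lt 0 x Hx). apply filter_imp. intros t Ht. symmetry.
    apply pos_power_nonpos; lra.
  - apply filterlim_locally. intros eps.
    (* the radius is the power 1 / y of eps *)
    exists (mkposreal _ (exp_pos (ln eps / y))). intros t Ht.
    rewrite (pos_power_nonpos 0 y) by lra.
    unfold ball in *; simpl in *; unfold AbsRing_ball, abs, minus, plus, opp in *; simpl in *.
    rewrite Ropp_0, Rplus_0_r in *.
    destruct (Rle_lt_dec t 0) as [Ht0 | Ht0].
    + rewrite pos_power_nonpos, Rabs_R0 by exact Ht0. apply cond_pos.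
    + rewrite pos_power_pos by exact Ht0. unfold Rpower.
      rewrite Rabs_pos_eq by (left; apply exp_pos).
      rewrite Rabs_pos_eq in Ht by lra.
      apply ln_increasing in Ht; [|exact Ht0]. rewrite ln_exp in Ht.
      rewrite <- (exp_ln eps) at 1 by apply cond_pos. apply exp_increasing.
      replace (ln eps) with (y * (ln eps / y)) by (field; lra).
      now apply Rmult_lt_compat_l.
  - apply (continuous_ext_loc _ (fun t => Rpower t y)).
    + generalize (open_gt 0 x Hx). apply filter_imp. intros t Ht. symmetry.
      now apply pos_power_pos.
    + apply (ex_derive_continuous (V := R_NormedModule)). eexists; now apply is_derive_Rpower.
Qed.

(** The combination of moments is the integral of the derivative of
rho z^n (z_+ - z)^(1 - alpha) (z_- - z)^alpha.  At z_- this function vanishes,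
as alpha > 0; at 0 it survives for n = 0 only. *)
Lemma G_recurrence rho theta n : 0 < rho -> 0 < theta ->
  sojourn_op rho theta (G rho theta) n =
  - (rho * 0 ^ n * Rpower (z_plus rho theta) (1 - alpha rho theta)
      * Rpower (z_minus rho theta) (alpha rho theta)).
Proof.
  intros Hr Ht.
  destruct (z_roots rho theta Hr Ht) as (Hz & Hsum & Hprod).
  assert (Hal := alpha_eq rho theta Hr Ht). assert (Hal1 := alpha_gt_1 rho theta Hr Ht).
  unfold sojourn_op, G.
  set (x := z_plus rho theta) in *. set (y := z_minus rho theta) in *.
  set (al := alpha rho theta) in *.
  pose (w := fun z => Rpower (x - z) (- al) * pos_power (y - z) (al - 1)).
  assert (Cw : forall t, 0 <= t <= y -> continuous w t).
  { intros t Ht'. apply (continuous_mult (K := R_AbsRing)).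
    - apply (continuous_comp (fun z => x - z) (fun u => Rpower u (- al))).
      + apply (continuous_minus (V := R_NormedModule));
          [apply continuous_const | apply continuous_id].
      + apply (ex_derive_continuous (V := R_NormedModule)). eexists; apply is_derive_Rpower; lra.
    - apply (continuous_comp (fun z => y - z) (fun u => pos_power u (al - 1))).
      + apply (continuous_minus (V := R_NormedModule));
          [apply continuous_const | apply continuous_id].
      + apply pos_power_continuous; lra. }
  pose (I := fun k => RInt (fun z => z ^ k * w z) 0 y).
  assert (HI : forall k, is_RInt (fun z => z ^ k * w z) 0 y (I k)).
  { intros k. apply (RInt_correct (V := R_CompleteNormedModule)).
    apply (ex_RInt_continuous (V := R_CompleteNormedModule)).
    rewrite Rmin_left, Rmax_right by lra. intros t Ht'.
    apply (continuous_mult (K := R_AbsRing)); [apply continuous_Rpow | now apply Cw]. }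
  assert (EI : forall k, RInt (fun z => z ^ k * Rpower (x - z) (- al) * Rpower (y - z) (al - 1))
    0 y = I k).
  { intros k. apply RInt_ext. rewrite Rmin_left, Rmax_right by lra. intros t Ht'.
    unfold w. rewrite pos_power_pos by lra. apply Rmult_assoc. }
  rewrite !EI.
  pose (F := fun z => rho * z ^ n * Rpower (x - z) (1 - al) * pos_power (y - z) al).
  pose (f := fun z => INR (S n) * rho * (z ^ S n * w z) - INR (S n) * (1 + rho + theta) *
    (z ^ n * w z)
     + INR n * (z ^ (n - 1) * w z)).
  assert (HF : is_RInt f 0 y (F y - F 0)).
  { apply is_RInt_derive_interior; [lra| | |].
    - intros t Ht'.
      apply (is_derive_ext_loc (fun z => rho * z ^ n * Rpower (x - z) (1 - al) * Rpower (y - z)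
        al)).
      { generalize (open_lt y t (proj2 Ht')). apply filter_imp. intros u Hu.
        unfold F. rewrite pos_power_pos by lra. reflexivity. }
      unfold Rpower. auto_derive; [lra|].
      unfold f, w. rewrite pos_power_pos by lra. unfold Rpower.
      assert (E1 : exp ((1 - al) * ln (x + - t)) = (x - t) * exp (- al * ln (x - t))).
      { rewrite <- (exp_ln (x - t)) at 1 by lra. rewrite <- exp_plus. f_equal.
        unfold Rminus; ring. }
      assert (E2 : exp (al * ln (y + - t)) = (y - t) * exp ((al - 1) * ln (y - t))).
      { rewrite <- (exp_ln (y - t)) at 1 by lra. rewrite <- exp_plus. f_equal.
        unfold Rminus; ring. }
      rewrite E1, E2.
      set (A := exp (- al * ln (x - t))). set (B := exp ((al - 1) * ln (y - t))).
      transitivity (A * B * (rho * INR n * t ^ Init.Nat.pred n * ((x - t) * (y - t))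
        - rho * t ^ n * (y - t + al * (x - y)))).
      { field; lra. }
      rewrite Hal, <- Hsum, S_INR. replace (n - 1)%nat with (Init.Nat.pred n) by lia.
      transitivity (A * B * (rho * INR n * t ^ Init.Nat.pred n * t * (t - (x + y))
        + INR n * t ^ Init.Nat.pred n * (rho * (x * y)) + rho * t ^ n * (t - (x + y)))); [ring|].
      rewrite Hprod. destruct n as [|k]; simpl pow; simpl Init.Nat.pred; [simpl INR; ring | ring].
    - intros t Ht'. unfold F.
      apply (continuous_mult (K := R_AbsRing)); [apply (continuous_mult (K := R_AbsRing));
       [apply (continuous_mult (K := R_AbsRing))|]|].
      + apply continuous_const.
      + apply continuous_Rpow.
      + apply (continuous_comp (fun z => x - z) (fun u => Rpower u (1 - al))).
        * apply (continuous_minus (V := R_NormedModule));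
            [apply continuous_const | apply continuous_id].
        * apply (ex_derive_continuous (V := R_NormedModule)).
          eexists; apply is_derive_Rpower; lra.
      + apply (continuous_comp (fun z => y - z) (fun u => pos_power u al)).
        * apply (continuous_minus (V := R_NormedModule));
            [apply continuous_const | apply continuous_id].
        * apply pos_power_continuous; lra.
    - intros t Ht'. unfold f.
      apply (continuous_plus (V := R_NormedModule));
        [apply (continuous_minus (V := R_NormedModule))|];
      (apply (continuous_mult (K := R_AbsRing)); [apply continuous_const|]);
      (apply (continuous_mult (K := R_AbsRing)); [apply continuous_Rpow | now apply Cw]). }
  assert (HF' : is_RInt f 0 y (INR (S n) * rho * I (S n) - INR (S n) * (1 + rho + theta) * I n +
    INR n * I (n - 1)%nat)).
  { apply (is_RInt_plus (V := R_NormedModule)); [apply (is_RInt_minus (V := R_NormedModule))|];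
    apply (is_RInt_scal (V := R_NormedModule)), HI. }
  rewrite <- (is_RInt_unique _ _ _ _ HF'), (is_RInt_unique _ _ _ _ HF).
  unfold F. rewrite (pos_power_nonpos (y - y)), (pos_power_pos (y - 0)), !Rminus_0_r by lra. ring.
Qed.

Lemma M_normalization rho theta : 0 < rho -> 0 < theta ->
  rho * Rpower (z_plus rho theta) (1 - alpha rho theta)
      * Rpower (z_minus rho theta) (alpha rho theta) * M rho theta = 1.
Proof.
  intros Hr Ht.
  destruct (z_roots rho theta Hr Ht) as (Hz & Hsum & Hprod).
  unfold M.
  set (x := z_plus rho theta) in *. set (y := z_minus rho theta) in *.
  set (al := alpha rho theta) in *.
  unfold Rpower, Rdiv. rewrite ln_mult, ln_Rinv; try apply Rinv_0_lt_compat; try lra.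
  transitivity (rho * y * exp ((1 - al) * ln x + al * ln y + al * (ln x + - ln y))).
  - rewrite !exp_plus. ring.
  - replace ((1 - al) * ln x + al * ln y + al * (ln x + - ln y)) with (ln x) by ring.
    rewrite exp_ln by lra. lra.
Qed.

(** * The three-term recurrence *)

Lemma sojourn_op_S rho theta x n :
  sojourn_op rho theta x (S n)
  = (INR n + 2) * rho * x (S (S n)) - (INR n + 2) * (1 + rho + theta) * x (S n) + (INR n + 1) *
    x n.
Proof. unfold sojourn_op. rewrite !S_INR. replace (S n - 1)%nat with n by lia. ring. Qed.

Lemma sojourn_op_0 rho theta x :
  sojourn_op rho theta x 0 = rho * x 1%nat - (1 + rho + theta) * x 0%nat.
Proof. unfold sojourn_op. simpl. ring. Qed.

(** Induction on (n + 2) rho (h_(n+2) - h_(n+1)) =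
((n + 2) theta + 1) h_(n+1) + (n + 1) (h_(n+1) - h_n). *)
Lemma homogeneous_increasing rho theta h : 0 < rho -> 0 < theta ->
  (forall n, sojourn_op rho theta h n = 0) -> h 0%nat = 1 ->
  forall n, 0 < h n < h (S n).
Proof.
  intros Hr Ht Hh H0. induction n as [|n [IH1 IH2]].
  - rewrite H0. specialize (Hh 0%nat). rewrite sojourn_op_0, H0 in Hh. nra.
  - split; [lra|]. specialize (Hh (S n)). rewrite sojourn_op_S in Hh.
    assert (Hn := pos_INR n).
    assert (E : (INR n + 2) * rho * (h (S (S n)) - h (S n))
      = (INR n + 2) * theta * h (S n) + h (S n) + (INR n + 1) * (h (S n) - h n)) by lra.
    assert (P1 : 0 < (INR n + 2) * theta * h (S n)) by (repeat apply Rmult_lt_0_compat; lra).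
    assert (P2 : 0 < (INR n + 1) * (h (S n) - h n)) by (apply Rmult_lt_0_compat; lra).
    assert (P3 : 0 < (INR n + 2) * rho) by (apply Rmult_lt_0_compat; lra).
    enough (0 < h (S (S n)) - h (S n)) by lra.
    apply (Rmult_lt_reg_l _ _ _ P3). lra.
Qed.

(** Multiplied by rho^n the recurrence becomes self-adjoint, so the weighted
Casoratian is constant from [n = 0] on, where the inhomogeneity of [G] gives
its value. *)
Lemma casoratian rho theta G h W :
  (forall n, sojourn_op rho theta h n = 0) -> h 0%nat = 1 ->
  (forall n, sojourn_op rho theta G n = - (W * 0 ^ n)) ->
  forall n, INR (S n) * rho ^ S n * (G n * h (S n) - G (S n) * h n) = W.
Proof.
  intros Hh H0 HG. induction n as [|n IH].
  - assert (E1 := Hh 0%nat). assert (E2 := HG 0%nat). rewrite sojourn_op_0 in E1, E2.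
    simpl in *. rewrite H0 in *. nra.
  - assert (E1 := Hh (S n)). assert (E2 := HG (S n)). rewrite sojourn_op_S in E1, E2.
    rewrite <- IH, !S_INR. simpl in E2. rewrite Rmult_0_l, Rmult_0_r, Ropp_0 in E2.
    transitivity (rho ^ S n * (G (S n) * ((INR n + 2) * rho * h (S (S n)))
       - h (S n) * ((INR n + 2) * rho * G (S (S n))))); [simpl; ring|].
    replace ((INR n + 2) * rho * h (S (S n))) with
      ((INR n + 2) * (1 + rho + theta) * h (S n) - (INR n + 1) * h n) by lra.
    replace ((INR n + 2) * rho * G (S (S n))) with
      ((INR n + 2) * (1 + rho + theta) * G (S n) - (INR n + 1) * G n) by lra.
    ring.
Qed.

Definition weighted_sum (rho : R) (x : nat -> R) (n : nat) : R :=
  sum_n (fun l => rho ^ l * x l) n.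

Lemma weighted_sum_S rho x n :
  weighted_sum rho x (S n) = weighted_sum rho x n + rho ^ S n * x (S n).
Proof. unfold weighted_sum. now rewrite sum_Sn. Qed.

Lemma weighted_sum_0 rho x : weighted_sum rho x 0 = x 0%nat.
Proof. unfold weighted_sum. rewrite sum_O. simpl; ring. Qed.

(** Variation of constants.  The sums range over l <= n, but their last terms
cancel, so that at n + 1 both may be replaced by the sums up to [n]. *)
Definition green_solution (rho M c : R) (G h : nat -> R) (n : nat) : R :=
  M * (G n * weighted_sum rho h n - h n * weighted_sum rho G n) + c * h n.

(** The sums contribute only through their increments, which produce the
Casoratian; for [n = 0] it is the inhomogeneity of [G] that gives -1. *)
Lemma green_solution_op rho theta M W c G h :
  W * M = 1 ->
  (forall n, sojourn_op rho theta h n = 0) -> h 0%nat = 1 ->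
  (forall n, sojourn_op rho theta G n = - (W * 0 ^ n)) ->
  forall n, sojourn_op rho theta (green_solution rho M c G h) n = -1.
Proof.
  intros HM Hh H0 HG. unfold green_solution. destruct n as [|n].
  - assert (E1 := Hh 0%nat). assert (E2 := HG 0%nat). rewrite sojourn_op_0 in *.
    rewrite !weighted_sum_S, !weighted_sum_0, H0 in *. simpl in *.
    transitivity (M * ((rho * G 1%nat - (1 + rho + theta) * G 0%nat) - G 0%nat *
      (rho * h 1%nat - (1 + rho + theta) * 1))
      + c * (rho * h 1%nat - (1 + rho + theta) * 1)); [ring|].
    rewrite E1, E2. lra.
  - assert (E1 := Hh (S n)). assert (E2 := HG (S n)). rewrite sojourn_op_S in *.
    assert (HW := casoratian rho theta G h W Hh H0 HG n). rewrite S_INR in HW.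
    simpl pow in E2. rewrite Rmult_0_l, Rmult_0_r, Ropp_0 in E2.
    rewrite !weighted_sum_S.
    set (A := weighted_sum rho h n). set (B := weighted_sum rho G n).
    transitivity (M * (A + rho ^ S n * h (S n)) *
      ((INR n + 2) * rho * G (S (S n)) - (INR n + 2) * (1 + rho + theta) * G (S n) + (INR n + 1)
        * G n)
      - M * (B + rho ^ S n * G (S n)) *
          ((INR n + 2) * rho * h (S (S n)) - (INR n + 2) * (1 + rho + theta) * h (S n) +
            (INR n + 1) * h n)
      + c * ((INR n + 2) * rho * h (S (S n)) - (INR n + 2) * (1 + rho + theta) * h (S n) +
          (INR n + 1) * h n)
      - M * ((INR n + 1) * rho ^ S n * (G n * h (S n) - G (S n) * h n))).
    + simpl pow. ring.
    + rewrite E1, E2, HW. lra.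
Qed.

(** The first term completes the sum of rho^l G_l over l > n up to [k]; the
second one is fixed by the boundary condition at [S k]. *)
Definition boundary_constant (rho M : R) (G h : nat -> R) (k : nat) : R :=
  M * weighted_sum rho G k - (G (S k) - G k) / (h (S k) - h k) * M * weighted_sum rho h k.

Lemma green_solution_boundary rho M G h k : h (S k) - h k <> 0 ->
  green_solution rho M (boundary_constant rho M G h k) G h (S k)
  = green_solution rho M (boundary_constant rho M G h k) G h k.
Proof.
  intros Hk. unfold green_solution, boundary_constant. rewrite !weighted_sum_S.
  field. exact Hk.
Qed.

Lemma green_solution_last rho theta M W G h k :
  0 < rho -> W * M = 1 ->
  (forall n, sojourn_op rho theta h n = 0) -> h 0%nat = 1 ->
  (forall n, sojourn_op rho theta G n = - (W * 0 ^ n)) ->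
  h (S k) - h k <> 0 ->
  green_solution rho M (boundary_constant rho M G h k) G h k
  = 1 / (INR (S k) * rho ^ S k * (h (S k) - h k)) * weighted_sum rho h k.
Proof.
  intros Hr HM Hh H0 HG Hk.
  assert (HW := casoratian rho theta G h W Hh H0 HG k).
  assert (Hi : INR (S k) <> 0) by (apply not_0_INR; lia).
  assert (Hp : rho ^ S k <> 0) by (apply pow_nonzero; lra).
  unfold green_solution, boundary_constant.
  transitivity (M * (INR (S k) * rho ^ S k * (G k * h (S k) - G (S k) * h k))
    / (INR (S k) * rho ^ S k * (h (S k) - h k)) * weighted_sum rho h k).
  - field. repeat split; assumption.
  - rewrite HW, (Rmult_comm M), HM. reflexivity.
Qed.

(** A solution is determined by its value at 0 up to a linear function of the
errors, so [d n - d 0 * h n] tends to 0.  The boundary condition then gives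
d_0 (h_(k+1) - h_k) -> 0, hence d_0 -> 0. *)
Lemma sojourn_op_stable rho theta h (d eps : R -> nat -> R) k :
  0 < rho ->
  (forall n, sojourn_op rho theta h n = 0) -> h 0%nat = 1 -> h (S k) - h k <> 0 ->
  (forall T, 0 < T -> forall n, (n <= k)%nat -> sojourn_op rho theta (d T) n = eps T n) ->
  (forall T, 0 < T -> d T (S k) = d T k) ->
  (forall n, (n <= k)%nat -> is_lim (fun T => eps T n) p_infty 0) ->
  forall n, (n <= k)%nat -> is_lim (fun T => d T n) p_infty 0.
Proof.
  intros Hr Hh H0 Hk Hd Hb He.
  assert (L0 : forall n, (n <= S k)%nat -> is_lim (fun T => d T n - d T 0%nat * h n) p_infty 0 /\
                      ((n <= k)%nat -> is_lim (fun T => d T (S n) - d T 0%nat * h (S n)) p_infty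
                        0)).
  { induction n as [|n IH]; intros Hn.
    - split.
      + apply (is_lim_ext (fun _ => 0)); [intros T; rewrite H0; ring | apply is_lim_const].
      + intros _. assert (E1 := Hh 0%nat). rewrite sojourn_op_0, H0 in E1.
        apply (is_lim_ext_loc (fun T => / rho * eps T 0%nat)).
        * exists 0. intros T HT. assert (E2 := Hd T HT 0%nat ltac:(lia)).
          rewrite sojourn_op_0 in E2.
          rewrite <- E2. replace (1 + rho + theta) with (rho * h 1%nat) by lra. field; lra.
        * replace (Finite 0) with (Rbar_mult (/ rho) 0) by (simpl; f_equal; ring).
          apply is_lim_scal_l, He; lia.
    - destruct IH as [IH1 IH2]; [lia|]. split; [apply IH2; lia|]. intros Hn'.
      assert (E1 := Hh (S n)). rewrite sojourn_op_S in E1.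
      assert (Pn := pos_INR n).
      specialize (IH2 ltac:(lia)).
      apply (is_lim_ext_loc (fun T => / ((INR n + 2) * rho) * (eps T (S n)
          + ((INR n + 2) * (1 + rho + theta) * (d T (S n) - d T 0%nat * h (S n))
             - (INR n + 1) * (d T n - d T 0%nat * h n))))).
      + exists 0. intros T HT. assert (E2 := Hd T HT (S n) ltac:(lia)).
        rewrite sojourn_op_S in E2.
        rewrite <- E2.
        replace (h (S (S n))) with (/ ((INR n + 2) * rho) *
          ((INR n + 2) * (1 + rho + theta) * h (S n) - (INR n + 1) * h n)).
        * field. lra.
        * apply (Rmult_eq_reg_l ((INR n + 2) * rho)); [|apply Rmult_integral_contrapositive; lra].
          rewrite <- Rmult_assoc, Rinv_r by (apply Rmult_integral_contrapositive; lra). lra.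
      + evar_last.
        * apply is_lim_scal_l. apply is_lim_plus'; [apply He; lia|].
          apply is_lim_minus'; apply (is_lim_scal_l _ _ _ 0); assumption.
        * simpl. f_equal. ring. }
  assert (Ld : is_lim (fun T => d T 0%nat) p_infty 0).
  { destruct (L0 k ltac:(lia)) as [H1 H2]. specialize (H2 ltac:(lia)).
    apply (is_lim_ext_loc (fun T => / (h (S k) - h k) *
      ((d T k - d T 0%nat * h k) - (d T (S k) - d T 0%nat * h (S k))))).
    - exists 0. intros T HT. rewrite Hb by exact HT. field; exact Hk.
    - evar_last; [apply is_lim_scal_l, is_lim_minus'; eassumption|]. simpl; f_equal; ring. }
  intros n Hn. destruct (L0 n ltac:(lia)) as [H1 _].
  apply (is_lim_ext (fun T => (d T n - d T 0%nat * h n) + h n * d T 0%nat)); [intros T; ring|].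
  evar_last.
  - apply is_lim_plus'; [exact H1 | apply (is_lim_scal_l _ _ _ 0), Ld].
  - simpl; f_equal; ring.
Qed.

(** * Laplace transforms of the densities *)

Definition energy (rho : R) (p : nat -> R -> R) (k : nat) (t : R) : R :=
  sum_n (fun n => INR (S n) * rho ^ n * p n t ^ 2) k.

(** With the weights (n + 1) rho^n the evolution is symmetric.  Summation by
parts turns the left-hand side into the boundary term on the right minus the
sum of 2 rho^n (n (x_n - x_(n-1))^2 + x_n^2). *)
Lemma dirichlet_form_bound rho (x : nat -> R) : 0 < rho -> forall k,
  sum_n (fun n => INR (S n) * rho ^ n * (2 * x n *
      (rho * x (S n) - (1 + rho) * x n + INR n / INR (n + 1) * x (n - 1)%nat))) k
  <= 2 * INR (S k) * rho ^ S k * x k * (x (S k) - x k).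
Proof.
  intros Hr. induction k as [|k IH].
  - rewrite sum_O. simpl. rewrite Rdiv_1_r. generalize (pow2_ge_0 (x 0%nat)); nra.
  - rewrite sum_Sn. eapply Rle_trans; [apply Rplus_le_compat_r, IH|].
    replace (S k - 1)%nat with k by lia. replace (S k + 1)%nat with (S (S k)) by lia.
    change plus with Rplus.
    assert (Hk := pos_INR (S k)). assert (Hi : INR (S (S k)) <> 0) by (apply not_0_INR; lia).
    assert (Hp : 0 < rho ^ S k) by now apply pow_lt.
    set (A := rho ^ S k) in *. set (m := INR (S k)) in *.
    replace (INR (S (S k)) * A * (2 * x (S k) *
      (rho * x (S (S k)) - (1 + rho) * x (S k) + m / INR (S (S k)) * x k)))
      with (2 * A * x (S k) * (INR (S (S k)) * (rho * x (S (S k)) - (1 + rho) * x (S k)) + m * x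
        k)) by (field; exact Hi).
    replace (INR (S (S k))) with (m + 1) by (unfold m; rewrite <- S_INR; reflexivity).
    replace (rho ^ S (S k)) with (rho * A) by reflexivity.
    assert (0 <= A * (m * (x (S k) - x k) ^ 2 + x (S k) ^ 2)).
    { apply Rmult_le_pos; [lra|]. apply Rplus_le_le_0_compat; [|apply pow2_ge_0].
      apply Rmult_le_pos; [exact Hk | apply pow2_ge_0]. }
    nra.
Qed.

Lemma term_le_sum_n (f : nat -> R) m n : (forall i, 0 <= f i) -> (n <= m)%nat -> f n <= sum_n f m.
Proof.
  intros Hf. induction m as [|m IH]; intros Hn.
  - replace n with 0%nat by lia. rewrite sum_O; lra.
  - rewrite sum_Sn. change plus with Rplus. destruct (Nat.eq_dec n (S m)) as [->|].
    + assert (0 <= sum_n f m); [|lra]. clear -Hf. induction m.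
      * rewrite sum_O; apply Hf.
      * rewrite sum_Sn. apply Rplus_le_le_0_compat; auto.
    + generalize (IH ltac:(lia)) (Hf (S m)); lra.
Qed.

Section Densities.

Variables (rho theta : R) (k : nat) (p : nat -> R -> R).
Hypothesis Hrho : 0 < rho.
Hypothesis Htheta : 0 < theta.
Hypothesis Hp : conditional_sojourn_densities rho (S k) p.

(** The boundary condition [p (S k) = p k] makes the boundary term of
[dirichlet_form_bound] vanish.  Time 1 is any time in the open half-line on
which the densities are differentiable. *)
Lemma energy_nonincreasing t : 1 <= t -> energy rho p k t <= energy rho p k 1.
Proof.
  intros Ht. destruct Hp as [Hev _ _ Hb].
  pose (D := fun t => sum_n (fun n => INR (S n) * rho ^ n * (2 * p n t *
      (rho * p (S n) t - (1 + rho) * p n t + INR n / INR (n + 1) * p (n - 1)%nat t))) k).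
  assert (HD : forall t, 0 < t -> is_derive (energy rho p k) t (D t)).
  { intros u Hu. apply (is_derive_sum_n (V := R_NormedModule)). intros n Hn.
    evar_last.
    - apply is_derive_scal, is_derive_pow, Hev; [lia | exact Hu].
    - simpl. ring. }
  destruct (MVT_gen (energy rho p k) 1 t D) as (c & Hc & E); rewrite ?Rmin_left,
    ?Rmax_right in * by lra.
  - intros u Hu. apply HD; lra.
  - intros u Hu. apply continuity_pt_filterlim, (ex_derive_continuous (V := R_NormedModule)).
    eexists. apply HD; lra.
  - enough (D c <= 0) by nra.
    eapply Rle_trans; [apply (dirichlet_form_bound rho (fun n => p n c) Hrho k)|].
    rewrite Hb by lra. replace (S k - 1)%nat with k by lia. lra.
Qed.

Lemma density_bounded n : (n <= k)%nat -> exists B, forall t, 1 <= t -> Rabs (p n t) <= B.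
Proof.
  intros Hn.
  assert (Hr : 0 < rho ^ n) by now apply pow_lt.
  assert (Hi : 0 < INR (S n)) by (apply lt_0_INR; lia).
  assert (Hw : 0 < INR (S n) * rho ^ n) by now apply Rmult_lt_0_compat.
  exists (1 + energy rho p k 1 / (INR (S n) * rho ^ n)). intros t Ht.
  assert (E := energy_nonincreasing t Ht).
  assert (E1 : INR (S n) * rho ^ n * p n t ^ 2 <= energy rho p k t).
  { apply (term_le_sum_n (fun n => INR (S n) * rho ^ n * p n t ^ 2)); [|exact Hn].
    intros i. apply Rmult_le_pos; [|apply pow2_ge_0].
    apply Rmult_le_pos; [apply pos_INR | apply pow_le; lra]. }
  assert (E2 : p n t ^ 2 <= energy rho p k 1 / (INR (S n) * rho ^ n)).
  { apply (proj1 (Rle_div_r _ _ _ Hw)); lra. }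
  rewrite <- pow2_abs in E2. nra.
Qed.

Lemma density_decay n : (n <= k)%nat ->
  is_lim (fun T => p n T * exp (- (theta * T))) p_infty 0.
Proof.
  intros Hn. destruct (density_bounded n Hn) as [B HB].
  assert (L : forall c, is_lim (fun T => c * exp (- (theta * T))) p_infty 0).
  { intros c. evar_last.
    - apply is_lim_scal_l. apply (is_lim_comp exp (fun T => - (theta * T)) p_infty 0 m_infty).
      + apply is_lim_exp_m.
      + evar_last. { apply is_lim_opp, is_lim_scal_l, is_lim_id. }
        simpl. destruct (Rle_dec 0 theta) as [H|H]; [|lra].
        destruct (Rle_lt_or_eq_dec 0 theta H); [reflexivity | lra].
      + exists 0. intros; discriminate.
    - simpl; f_equal; ring. }
  apply (is_lim_le_le_loc (fun T => (- B) * exp (- (theta * T)))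
    (fun T => B * exp (- (theta * T)))); try apply L.
  exists 1. intros T HT. specialize (HB T ltac:(lra)).
  apply Rabs_le_between in HB. assert (He := exp_pos (- (theta * T))).
  split; apply Rmult_le_compat_r; lra.
Qed.

(** Frozen at its initial value for negative times, the density is continuous on
both sides of 0. *)
Definition extended_density (n : nat) (t : R) : R := p n (Rmax 0 t).

Lemma extended_density_eq n t : 0 <= t -> extended_density n t = p n t.
Proof. intros Ht. unfold extended_density. now rewrite Rmax_right. Qed.

Lemma extended_density_continuous n t : (n <= S k)%nat -> 0 <= t ->
  continuous (extended_density n) t.
Proof.
  destruct Hp as [Hev _ Hrc Hb].
  assert (Main : forall n t, (n <= k)%nat -> 0 <= t -> continuous (extended_density n) t).
  { clear n t. intros n t Hn [Ht | <-].
    - apply (continuous_ext_loc _ (p n)).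
      + generalize (open_gt 0 t Ht). apply filter_imp. intros u Hu. symmetry.
        apply extended_density_eq; lra.
      + apply (ex_derive_continuous (V := R_NormedModule)). eexists. apply Hev; [lia | exact Ht].
    - apply filterlim_locally. intros eps. rewrite extended_density_eq by lra.
      assert (H0 := proj1 (filterlim_locally (F := at_right 0) (p n) (p n 0)) (Hrc n ltac:(lia))
        eps).
      destruct H0 as [del Hdel]. exists del. intros u Hu. unfold extended_density.
      destruct (Rle_lt_dec u 0) as [Hu0 | Hu0].
      + rewrite Rmax_left by exact Hu0. apply ball_center.
      + rewrite Rmax_right by lra. now apply Hdel. }
  intros Hn Ht. destruct (Nat.eq_dec n (S k)) as [->|]; [|apply Main; [lia | exact Ht]].
  apply (continuous_ext (extended_density k)); [|now apply Main].
  intros u. unfold extended_density. rewrite Hb by apply Rmax_l. f_equal; lia.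
Qed.

Definition truncated_laplace (T : R) (n : nat) : R :=
  RInt (fun t => p n t * exp (- (theta * t))) 0 T.

Lemma continuous_exp_decay t : continuous (fun t => exp (- (theta * t))) t.
Proof. apply (ex_derive_continuous (V := R_NormedModule)). auto_derive. auto. Qed.

Lemma is_RInt_truncated_laplace T n : 0 < T -> (n <= S k)%nat ->
  is_RInt (fun t => extended_density n t * exp (- (theta * t))) 0 T (truncated_laplace T n).
Proof.
  intros HT Hn. unfold truncated_laplace.
  rewrite (RInt_ext _ (fun t => extended_density n t * exp (- (theta * t)))).
  2: { rewrite Rmin_left, Rmax_right by lra. intros t Ht.
  now rewrite extended_density_eq by lra. }
  apply (RInt_correct (V := R_CompleteNormedModule)),
    (ex_RInt_continuous (V := R_CompleteNormedModule)).
  rewrite Rmin_left, Rmax_right by lra. intros t Ht.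
  apply (continuous_mult (K := R_AbsRing));
    [apply extended_density_continuous; [exact Hn | lra] | apply continuous_exp_decay].
Qed.

(** Integration of (p_n e^(-theta t))' over [0, T]: the initial value yields -1
and the final one the error term. *)
Lemma truncated_laplace_op T n : 0 < T -> (n <= k)%nat ->
  sojourn_op rho theta (truncated_laplace T) n
  = INR (S n) * (p n T * exp (- (theta * T))) - 1.
Proof.
  intros HT Hn.
  assert (Hi : INR (S n) <> 0) by (apply not_0_INR; lia).
  pose (q := extended_density).
  pose (f := fun t => q n t * exp (- (theta * t))).
  pose (df := fun t => rho * (q (S n) t * exp (- (theta * t))) - (1 + rho + theta) *
    (q n t * exp (- (theta * t)))
     + INR n / INR (S n) * (q (n - 1)%nat t * exp (- (theta * t)))).
  assert (Cq : forall m t, (m <= S k)%nat -> 0 <= t ->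
    continuous (fun t => q m t * exp (- (theta * t))) t).
  { intros m t Hm Ht. apply (continuous_mult (K := R_AbsRing));
      [now apply extended_density_continuous | apply continuous_exp_decay]. }
  assert (I1 : is_RInt df 0 T (f T - f 0)).
  { apply is_RInt_derive_interior; [exact HT| | |].
    - intros t Ht. apply (is_derive_ext_loc (fun t => p n t * exp (- (theta * t)))).
      { generalize (open_gt 0 t (proj1 Ht)). apply filter_imp. intros u Hu. unfold f, q.
        now rewrite extended_density_eq by lra. }
      assert (D1 := csd_evolution _ _ _ Hp n t ltac:(lia) (proj1 Ht)).
      evar_last.
      + apply (is_derive_mult (K := R_AbsRing)); [exact D1 | | apply Rmult_comm].
        instantiate (1 := - theta * exp (- (theta * t))). auto_derive; [auto | ring].
      + unfold df, q. rewrite !extended_density_eq by lra. rewrite Nat.add_1_r.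
        unfold plus, mult; simpl. ring.
    - intros t Ht. apply Cq; [lia | lra].
    - intros t Ht.
      apply (continuous_plus (V := R_NormedModule));
        [apply (continuous_minus (V := R_NormedModule))|];
      (apply (continuous_mult (K := R_AbsRing));
        [apply continuous_const | apply Cq; [lia | lra]]). }
  assert (I2 : is_RInt df 0 T (rho * truncated_laplace T (S n) - (1 + rho + theta) *
    truncated_laplace T n
     + INR n / INR (S n) * truncated_laplace T (n - 1)%nat)).
  { apply (is_RInt_plus (V := R_NormedModule)); [apply (is_RInt_minus (V := R_NormedModule))|];
    apply (is_RInt_scal (V := R_NormedModule)), is_RInt_truncated_laplace; try exact HT; lia. }
  apply (is_RInt_unique (V := R_CompleteNormedModule)) in I1.
  apply (is_RInt_unique (V := R_CompleteNormedModule)) in I2. rewrite I1 in I2.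
  unfold f, q in I2. rewrite !extended_density_eq in I2 by lra.
  rewrite (csd_initial _ _ _ Hp n) in I2 by lia.
  rewrite Nat.add_1_r, Rmult_0_r, Ropp_0, exp_0 in I2.
  unfold sojourn_op.
  transitivity (INR (S n) * (p n T * exp (- (theta * T)) - 1 / INR (S n) * 1));
    [|field; exact Hi].
  rewrite I2. field; exact Hi.
Qed.

Lemma truncated_laplace_boundary T : 0 < T -> truncated_laplace T (S k) = truncated_laplace T k.
Proof.
  intros HT. apply RInt_ext. rewrite Rmin_left, Rmax_right by lra. intros t Ht.
  rewrite (csd_boundary _ _ _ Hp) by lra. now replace (S k - 1)%nat with k by lia.
Qed.

(** The difference between the truncated transforms and [X] satisfies the
boundary value problem with errors that tend to 0. *)
Lemma is_laplace_of_solution (h X : nat -> R) :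
  (forall n, sojourn_op rho theta h n = 0) -> h 0%nat = 1 ->
  (forall n, sojourn_op rho theta X n = -1) -> X (S k) = X k ->
  forall n, (n <= k)%nat ->
  is_RInt_gen (fun t => p n t * exp (- (theta * t))) (at_point 0) (Rbar_locally p_infty) (X n).
Proof.
  intros Hh H0 HX Hb n Hn.
  assert (Hk : h (S k) - h k <> 0).
  { generalize (homogeneous_increasing rho theta h Hrho Htheta Hh H0 k); lra. }
  assert (L : is_lim (fun T => truncated_laplace T n) p_infty (X n)).
  { apply (is_lim_ext (fun T => (truncated_laplace T n - X n) + X n)); [intros; ring|].
    replace (Finite (X n)) with (Finite (0 + X n)) by (f_equal; ring).
    apply is_lim_plus'; [|apply is_lim_const].
    apply (sojourn_op_stable rho theta h (fun T n => truncated_laplace T n - X n)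
      (fun T n => INR (S n) * (p n T * exp (- (theta * T)))) k); try assumption.
    - intros T HT m Hm.
      transitivity (sojourn_op rho theta (truncated_laplace T) m - sojourn_op rho theta X m);
        [unfold sojourn_op; ring|].
      rewrite truncated_laplace_op, HX by assumption. ring.
    - intros T HT. rewrite truncated_laplace_boundary, Hb by assumption. reflexivity.
    - intros m Hm. evar_last; [apply is_lim_scal_l, density_decay, Hm|]. simpl; f_equal; ring. }
  intros P HP. specialize (L P HP).
  destruct L as [A HA].
  exists (fun a => a = 0) (fun b => Rmax A 0 < b).
  - reflexivity.
  - exists (Rmax A 0). auto.
  - intros x y -> Hy. exists (truncated_laplace y n).
    assert (Hy1 : A < y) by (generalize (Rmax_l A 0); lra).
    assert (Hy2 : 0 < y) by (generalize (Rmax_r A 0); lra).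
    split; [|now apply HA].
    apply (is_RInt_ext (fun t => extended_density n t * exp (- (theta * t)))).
    + simpl. rewrite Rmin_left, Rmax_right by lra. intros t Ht.
      now rewrite extended_density_eq by lra.
    + apply is_RInt_truncated_laplace; [exact Hy2 | lia].
Qed.

End Densities.

(** * The formula *)

Lemma H_recurrence rho theta Phi g n :
  0 < rho -> 0 < theta -> integrand_branch rho theta Phi ->
  encircles_counterclockwise g (z_minus rho theta) (z_plus rho theta) ->
  (RtoC (INR (S n) * rho) * H rho theta Phi g (S n)
   - RtoC (INR (S n) * (1 + rho + theta)) * H rho theta Phi g n
   + RtoC (INR n) * H rho theta Phi g (n - 1) = 0)%C.
Proof.
  intros Hr Ht HPhi Hg.
  assert (E := contour_recurrence rho theta Phi g Hr Ht HPhi Hg n).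
  unfold H. set (k := (Cexp _ / _)%C).
  transitivity (k * 0)%C; [rewrite <- E|]; ring.
Qed.

Lemma Re_scal_l x z : Re (RtoC x * z)%C = x * Re z.
Proof. unfold Re; simpl; ring. Qed.

Lemma Im_scal_l x z : Im (RtoC x * z)%C = x * Im z.
Proof. unfold Im; simpl; ring. Qed.

Lemma Re_H_recurrence rho theta Phi g n :
  0 < rho -> 0 < theta -> integrand_branch rho theta Phi ->
  encircles_counterclockwise g (z_minus rho theta) (z_plus rho theta) ->
  sojourn_op rho theta (fun n => Re (H rho theta Phi g n)) n = 0.
Proof.
  intros Hr Ht HPhi Hg.
  assert (E := f_equal Re (H_recurrence rho theta Phi g n Hr Ht HPhi Hg)).
  unfold sojourn_op. rewrite <- !Re_scal_l. exact E.
Qed.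

(** The imaginary parts satisfy the same real recurrence, and start from 0. *)
Lemma H_real rho theta Phi g :
  0 < rho -> 0 < theta -> integrand_branch rho theta Phi ->
  encircles_counterclockwise g (z_minus rho theta) (z_plus rho theta) ->
  forall n, H rho theta Phi g n = RtoC (Re (H rho theta Phi g n)).
Proof.
  intros Hr Ht HPhi Hg.
  pose (y := fun n => Im (H rho theta Phi g n)).
  assert (Hy : forall n, sojourn_op rho theta y n = 0).
  { intros n. assert (E := f_equal Im (H_recurrence rho theta Phi g n Hr Ht HPhi Hg)).
    unfold sojourn_op, y. rewrite <- !Im_scal_l. exact E. }
  assert (Hy0 : forall n, y n = 0 /\ y (S n) = 0).
  { induction n as [|n [IH1 IH2]].
    - assert (y 0%nat = 0) by (unfold y; rewrite H_0 by assumption; reflexivity).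
      split; [assumption|]. specialize (Hy 0%nat). rewrite sojourn_op_0 in Hy. nra.
    - split; [exact IH2|]. specialize (Hy (S n)). rewrite sojourn_op_S, IH1, IH2 in Hy.
      assert (Hn := pos_INR n).
      apply (Rmult_eq_reg_l ((INR n + 2) * rho)); [lra|].
      apply Rmult_integral_contrapositive; lra. }
  intros n. generalize (proj1 (Hy0 n)). unfold y.
  destruct (H rho theta Phi g n) as [u v]. simpl. intros ->. reflexivity.
Qed.

Lemma sum_n_m_RtoC (f : nat -> R) n m :
  sum_n_m (G := C_AbelianMonoid) (fun l => RtoC (f l)) n m = RtoC (sum_n_m f n m).
Proof.
  destruct (Nat.le_gt_cases n m) as [Hnm | Hnm].
  - induction Hnm as [|m Hnm IH].
    + now rewrite !sum_n_n.
    + rewrite !sum_n_Sm by lia. rewrite IH. symmetry. apply RtoC_plus.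
  - now rewrite !sum_n_m_zero by exact Hnm.
Qed.

Theorem theorem2p1 :
  forall (rho : R) (K : nat) (p : nat -> R -> R),
    0 < rho ->
    (1 <= K)%nat ->
    conditional_sojourn_densities rho K p ->
  forall (theta : R) (Phi : C -> C) (contour : R -> C),
    0 < theta ->
    integrand_branch rho theta Phi ->
    encircles_counterclockwise contour (z_minus rho theta) (z_plus rho theta) ->
    let phat := fun n : nat => RtoC (laplace (p n) theta) in
    let r := RtoC rho in
    let M := RtoC (M rho theta) in
    let G := fun n : nat => RtoC (G rho theta n) in
    let H := H rho theta Phi contour in
    let DG := RtoC (Delta_G rho theta K) in
    let DH := Delta_H rho theta Phi contour K in
    (forall n : nat, (n <= K - 1)%nat -> ex_laplace (p n) theta) /\
    (forall n : nat, (n + 2 <= K)%nat ->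
       phat n =
         (M * G n * sum_n_m (fun l => r ^ l * H l) 0 n
          + M * H n * sum_n_m (fun l => r ^ l * G l) (n + 1) (K - 1)
          - DG / DH * M * H n * sum_n_m (fun l => r ^ l * H l) 0 (K - 1))%C) /\
    phat (K - 1)%nat =
      (1 / (RtoC (INR K) * r ^ K * DH)
       * sum_n_m (fun l => r ^ l * H l) 0 (K - 1))%C.
Proof.
  intros rho [|k] p Hr HK Hp theta Phi contour Ht HPhi Hg; [lia|].
  intros phat r M0 G0 H0 DG DH.
  pose (h := fun n => Re (H rho theta Phi contour n)).
  assert (EH : forall n, H0 n = RtoC (h n)) by (intros; now apply H_real).
  assert (Hh : forall n, sojourn_op rho theta h n = 0) by (intros; now apply Re_H_recurrence).
  assert (Hh0 : h 0%nat = 1) by (unfold h; rewrite H_0 by assumption; reflexivity).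
  assert (Hk : h (S k) - h k <> 0).
  { generalize (homogeneous_increasing rho theta h Hr Ht Hh Hh0 k); lra. }
  pose (W := rho * Rpower (z_plus rho theta) (1 - alpha rho theta)
      * Rpower (z_minus rho theta) (alpha rho theta)).
  assert (HG : forall n, sojourn_op rho theta (G rho theta) n = - (W * 0 ^ n)).
  { intros n. rewrite G_recurrence by assumption. unfold W. ring. }
  assert (HW : W * M rho theta = 1) by now apply M_normalization.
  pose (X := green_solution rho (M rho theta)
    (boundary_constant rho (M rho theta) (G rho theta) h k) (G rho theta) h).
  assert (HL : forall n, (n <= k)%nat ->
    is_RInt_gen (fun t => p n t * exp (- (theta * t))) (at_point 0) (Rbar_locally p_infty) (X n)).
  { apply (is_laplace_of_solution rho theta k p Hr Ht Hp h X Hh Hh0).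
    - intros n. now apply green_solution_op with W.
    - now apply green_solution_boundary. }
  assert (Hphat : forall n, (n <= k)%nat -> phat n = RtoC (X n)).
  { intros n Hn. unfold phat, laplace. f_equal.
    apply (is_RInt_gen_unique (V := R_CompleteNormedModule)), HL, Hn. }
  replace (S k - 1)%nat with k by lia.
  assert (ES : forall n m, sum_n_m (G := C_AbelianMonoid) (fun l => r ^ l * H0 l)%C n m
    = RtoC (sum_n_m (fun l => rho ^ l * h l) n m)).
  { intros n m. rewrite <- sum_n_m_RtoC. apply sum_n_m_ext. intros l.
    rewrite EH. unfold r. now rewrite RtoC_mult, RtoC_pow. }
  assert (EG : forall n m, sum_n_m (G := C_AbelianMonoid) (fun l => r ^ l * G0 l)%C n m
    = RtoC (sum_n_m (fun l => rho ^ l * G rho theta l) n m)).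
  { intros n m. rewrite <- sum_n_m_RtoC. apply sum_n_m_ext. intros l.
    unfold r, G0. now rewrite RtoC_mult, RtoC_pow. }
  assert (EDH : DH = RtoC (h (S k) - h k)).
  { unfold DH, Delta_H. fold H0. replace (S k - 1)%nat with k by lia. rewrite !EH.
    now rewrite RtoC_minus. }
  assert (EDG : DG = RtoC (G rho theta (S k) - G rho theta k)).
  { unfold DG, Delta_G. now replace (S k - 1)%nat with k by lia. }
  repeat split.
  - intros n Hn. exists (X n). now apply HL.
  - intros n Hn. rewrite Hphat by lia.
    rewrite !ES, EG, EH, EDH, EDG. unfold M0, G0.
    rewrite <- RtoC_div by exact Hk. rewrite <- !RtoC_mult, <- RtoC_plus, <- RtoC_minus. f_equal.
    unfold X, green_solution, boundary_constant, weighted_sum, sum_n.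
    rewrite (sum_n_m_Chasles (fun l => rho ^ l * G rho theta l) 0 n k) by lia.
    rewrite Nat.add_1_r. unfold plus; simpl. field. exact Hk.
  - rewrite Hphat by lia. rewrite ES, EDH. unfold r.
    rewrite <- RtoC_pow, <- !RtoC_mult, <- RtoC_div, <- RtoC_mult.
    + f_equal. unfold X. now apply green_solution_last with theta W.
    + apply Rmult_integral_contrapositive_currified; [|exact Hk].
      apply Rmult_integral_contrapositive_currified;
        [apply not_0_INR; lia | apply pow_nonzero; lra].
Qed.
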